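(* Let $X$ be a locally compact metric space, let $f_0,f_1\colon X\to X$ be continuous maps, and let $S_0,S_1\subset X$ be isolated invariant sets for $f_0$ and $f_1$, respectively. If there is a continuation from $(S_0,f_0)$ to $(S_1,f_1)$, then $\operatorname{CT}(S_0,f_0)=\operatorname{CT}(S_1,f_1)$.
   Context: For a continuous map $f\colon X\to X$ and $M\subset X$, $\operatorname{Inv}(M,f)$ is the set of $x\in M$ for which there is a sequence $\gamma\colon\mathbb{Z}\to M$ with $\gamma(0)=x$ and $\gamma(n+1)=f(\gamma(n))$ for all $n\in\mathbb{Z}$. A set $S\subset X$ is isolated invariant for $f$ if it is compact and has a neighborhood $M$ with $\operatorname{Inv}(M,f)=S$. Continuation: a collection $\{(S_t,f_t)\mid t\in[0,1]\}$ of sets $S_t\subset X$ and maps $f_t\colon X\to X$ is a continuation from $(S_0,f_0)$ to $(S_1,f_1)$ if the map $F\colon X\times[0,1]\to X\times[0,1]$, $F(x,t)=(f_t(x),t)$, is continuous and $\Sigma=\{(x,t)\in X\times[0,1]\mid x\in S_t\}$ is an isolated invariant set for $F$. Quotients: for $\varnothing\ne Y\subset Z$, $Z/Y$ is the pointed quotient space with base point $[Y]$; $Z/\varnothing:=Z\sqcup\{*\}$ with base point $*$ (denoted $[\varnothing]$). Index pairs: a pair $(N,L)$ of compact sets $L\subset N\subset X$ is an index pair for $(S,f)$ if $\operatorname{Inv}(\operatorname{cl}(N\setminus L),f)=S\subset\operatorname{int}(N\setminus L)$ and the map $f_{(N,L)}\colon N/L\to N/L$ given by $f_{(N,L)}([x])=[f(x)]$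 if $x,f(x)\in N\setminus L$ and $f_{(N,L)}([x])=[L]$ otherwise is continuous. The mapping torus of a continuous map $\kappa\colon P\to P$ is $\operatorname{T}(\kappa):=(P\times[0,1])/\big((x,1)\sim(\kappa(x),0)\big)$. The (unreduced) mapping torus index $\operatorname{CT}(S,f)$ is the (unpointed) homotopy type of $\operatorname{T}(f_{(N,L)})$ for an index pair $(N,L)$ for $(S,f)$; it does not depend on the choice of index pair. *)

(* Defs.v *)
From HB Require Import structures.
From mathcomp Require Import all_boot all_order all_algebra generic_quotient.
From mathcomp Require Import all_classical all_reals all_analysis.
From Stdlib Require Import Relation_Operators.

Set Implicit Arguments.
Unset Strict Implicit.
Unset Printing Implicit Defensive.

Import Order.TTheory GRing.Theory Num.Theory.
Import numFieldNormedType.Exports.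

Local Open Scope classical_set_scope.
Local Open Scope ring_scope.
Local Open Scope quotient_scope.

(* Used as a type through the coercion [set_type], hence with the subspace
   topology of [R]. *)
Definition unit_itv (R : realType) : set R := [set t | 0 <= t <= 1].
Arguments unit_itv R : clear implicits.

Lemma unit_itv0_proof (R : realType) : (0 : R) \in unit_itv R.
Proof. by apply: mem_set; rewrite /unit_itv /= lexx ler01. Qed.

Lemma unit_itv1_proof (R : realType) : (1 : R) \in unit_itv R.
Proof. by apply: mem_set; rewrite /unit_itv /= lexx ler01. Qed.

Definition itv0 (R : realType) : unit_itv R := exist _ 0 (unit_itv0_proof R).
Definition itv1 (R : realType) : unit_itv R := exist _ 1 (unit_itv1_proof R).

Definition inv_set (X : Type) (M : set X) (f : X -> X) : set X :=
  [set x | M x /\ exists gamma : int -> X,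
     [/\ forall n, M (gamma n), gamma 0 = x &
         forall n, gamma (n + 1) = f (gamma n)]].

Definition isolated_invariant (X : topologicalType) (S : set X) (f : X -> X) :=
  compact S /\ exists M : set X, S `<=` interior M /\ inv_set M f = S.

Definition is_continuation (R : realType) (X : topologicalType)
    (S_ : unit_itv R -> set X) (f_ : unit_itv R -> X -> X)
    (S0 : set X) (f0 : X -> X) (S1 : set X) (f1 : X -> X) :=
  let F := fun p : X * unit_itv R => (f_ p.2 p.1, p.2) in
  let Sigma := [set p : X * unit_itv R | S_ p.2 p.1] in
  [/\ S_ (itv0 R) = S0 /\ f_ (itv0 R) = f0,
      S_ (itv1 R) = S1 /\ f_ (itv1 R) = f1,
      continuous F & isolated_invariant Sigma F].

(* The disjoint union of [Z] and an isolated point [None]; a copy of [option Z],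
   on which no topology is inherited from the library. *)
Definition add_point (Z : Type) : Type := option Z.

HB.instance Definition _ (Z : choiceType) := Choice.on (add_point Z).

Section add_point_topology.
Variable Z : topologicalType.

Definition add_point_open (U : set (add_point Z)) : Prop :=
  open [set z : Z | U (Some z)].

Lemma add_point_openT : add_point_open setT.
Proof. exact: openT. Qed.

Lemma add_point_openI (U V : set (add_point Z)) :
  add_point_open U -> add_point_open V -> add_point_open (U `&` V).
Proof. exact: openI. Qed.

Lemma add_point_open_bigcup (I : Type) (U : I -> set (add_point Z)) :
  (forall i, add_point_open (U i)) -> add_point_open (\bigcup_i U i).
Proof.
move=> oU; rewrite /add_point_open.
rewrite (_ : [set z | _] = \bigcup_i [set z | U i (Some z)]).
  by apply: bigcup_open => i _; exact: oU.
by apply/seteqP; split.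
Qed.

HB.instance Definition _ := @isOpenTopological.Build (add_point Z)
  add_point_open add_point_openT add_point_openI add_point_open_bigcup.

End add_point_topology.

Section pquot.
Variables (Z : topologicalType) (Y : set Z).

(* [u] is the added point or a point of [Y] *)
Definition collapsed (u : add_point Z) : Prop :=
  if u is Some z then Y z else True.

Definition pquot_rel (u v : add_point Z) : bool :=
  `[< u = v \/ collapsed u /\ collapsed v >].

Lemma pquot_rel_refl : reflexive pquot_rel.
Proof. by move=> u; apply/asboolP; left. Qed.

Lemma pquot_rel_sym : symmetric pquot_rel.
Proof.
by move=> u v; apply/asboolP/asboolP => -[->|[? ?]]; [left|right|left|right].
Qed.

Lemma pquot_rel_trans : transitive pquot_rel.
Proof.
move=> v u w /asboolP uv /asboolP vw; apply/asboolP.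
by move: uv vw => [->//|[cu cv]] [<-|[_ cw]]; right.
Qed.

Canonical pquot_equiv :=
  EquivRel pquot_rel pquot_rel_refl pquot_rel_sym pquot_rel_trans.

(* [Z / Y], uniformly in [Y], as [(Z + {*}) / (Y + {*})]: this is [Z + {*}] if
   [Y] is empty, and the quotient of [Z] collapsing [Y] to a point otherwise. *)
Definition pquot : Type := quotient_topology {eq_quot pquot_equiv}.

HB.instance Definition _ := Topological.on pquot.
HB.instance Definition _ := Quotient.on pquot.

Definition pquot_class (z : Z) : pquot := \pi_pquot (Some z : add_point Z).
Definition pquot_base : pquot := \pi_pquot (None : add_point Z).

End pquot.

Section index_pair_map.
Variables (X : topologicalType) (f : X -> X) (N L : set X).

(* [L] is read as a subset of the space [N]; it is only used with [L `<=` N] *)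
Definition index_quot : Type := pquot (set_val @^-1` L : set N).

HB.instance Definition _ := Topological.on index_quot.
HB.instance Definition _ := Quotient.on index_quot.

Definition index_base : index_quot := pquot_base (set_val @^-1` L : set N).

(* [x], a junk value if [x] is not in [N] *)
Definition index_class (x : X) : index_quot :=
  if insub x is Some y then pquot_class (set_val @^-1` L) y else index_base.

(* Both cases below are independent of the representative: the class of a point
   of [N `\` L] is a singleton (see [index_pair_map_class]). *)
Definition index_pair_map (q : index_quot) : index_quot :=
  if (repr q : add_point N) is Some y then
    if `[< (N `\` L) (set_val y) /\ (N `\` L) (f (set_val y)) >]
    then index_class (f (set_val y)) else index_base
  else index_base.

Lemma index_pair_map_class (y : N) :
  index_pair_map (pquot_class (set_val @^-1` L) y) =
  if `[< (N `\` L) (set_val y) /\ (N `\` L) (f (set_val y)) >]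
  then index_class (f (set_val y)) else index_base.
Proof.
rewrite /index_pair_map.
have /eqmodP/asboolP :
    pquot_class (set_val @^-1` L) y =
      \pi_index_quot (repr (pquot_class (set_val @^-1` L) y)).
  by rewrite reprK.
case=> [<-//|[/= Ly]].
have -> : `[< (N `\` L) (set_val y) /\ (N `\` L) (f (set_val y)) >] = false.
  by apply/asboolP => -[[]].
case: (repr _) => //= z Lz.
by case: ifPn => // /asboolP[[]].
Qed.

Lemma index_pair_map_base : index_pair_map index_base = index_base.
Proof.
rewrite /index_pair_map.
have /eqmodP/asboolP : index_base = \pi_index_quot (repr index_base).
  by rewrite reprK.
case=> [<-//|[_]].
case: (repr _) => //= z Lz.
by case: ifPn => // /asboolP[[]].
Qed.

End index_pair_map.

Definition index_pair (X : topologicalType) (S : set X) (f : X -> X)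
    (N L : set X) :=
  [/\ compact N, compact L & L `<=` N] /\
  [/\ inv_set (closure (N `\` L)) f = S,
      S `<=` interior (N `\` L) &
      continuous (@index_pair_map X f N L)].

Section mapping_torus.
Variables (R : realType) (P : topologicalType) (kappa : P -> P).

Definition torus_gluing (u v : P * unit_itv R) : Prop :=
  u.2 = itv1 R /\ v = (kappa u.1, itv0 R).

Definition torus_rel (u v : P * unit_itv R) : bool :=
  `[< clos_refl_sym_trans _ torus_gluing u v >].

Lemma torus_rel_refl : reflexive torus_rel.
Proof. by move=> u; apply/asboolP; exact: rst_refl. Qed.

Lemma torus_rel_sym : symmetric torus_rel.
Proof. by move=> u v; apply/asboolP/asboolP => ?; exact: rst_sym. Qed.

Lemma torus_rel_trans : transitive torus_rel.
Proof.
by move=> v u w /asboolP uv /asboolP vw; apply/asboolP; exact: rst_trans uv vw.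
Qed.

Canonical torus_equiv :=
  EquivRel torus_rel torus_rel_refl torus_rel_sym torus_rel_trans.

Definition mapping_torus : Type := quotient_topology {eq_quot torus_equiv}.

HB.instance Definition _ := Topological.on mapping_torus.
HB.instance Definition _ := Quotient.on mapping_torus.

End mapping_torus.

Definition homotopic (R : realType) (P Q : topologicalType) (g h : P -> Q) :=
  exists H : P * unit_itv R -> Q,
    [/\ continuous H, forall x, H (x, itv0 R) = g x &
        forall x, H (x, itv1 R) = h x].

Definition homotopy_equivalent (R : realType) (P Q : topologicalType) :=
  exists (g : P -> Q) (h : Q -> P),
    [/\ continuous g, continuous h, homotopic R (h \o g) id &
        homotopic R (g \o h) id].

(* A homotopy type is represented by the class of all spaces having it. The
   class below is a homotopy type if index pairs exist and all give homotopy
   equivalent mapping tori, and is empty otherwise. *)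
Definition CT (R : realType) (X : topologicalType) (S : set X) (f : X -> X) :
    topologicalType -> Prop :=
  fun P => (exists N L, index_pair S f N L) /\
    forall N L, index_pair S f N L ->
      homotopy_equivalent R P (mapping_torus R (@index_pair_map X f N L)).

(* Main.v *)
Require Import Defs.
From HB Require Import structures.
From mathcomp Require Import all_boot all_order all_algebra generic_quotient.
From mathcomp Require Import all_classical all_reals all_analysis.
From mathcomp Require Import zify lra.
From Stdlib Require Import Relation_Operators.

(* Along a continuation, some pair (N, L) is an index pair for every parameter
   near a given one, and the index maps on N/L are then homotopic through the
   parameter. Two index pairs of the same isolated invariant set have shift
   equivalent index maps. Both homotopic maps and shift equivalent maps have
   homotopy equivalent mapping tori: in a mapping torus, a map is homotopic to
   the identity along the suspension semiflow. Hence the index is locally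
   constant in the parameter, and [0, 1] is connected.

   The pair (N, L) comes from pseudo-orbits in an isolating neighbourhood W. For
   small e, let C(d) be the set of points that end an infinite backward
   e-pseudo-orbit in W and start an infinite forward d-pseudo-orbit in W. Take
   N = cl C(e) and L = N \ f^-1 C(e/2). With K = cl(N \ L), this gives
   f(K) in int N and f(L) disjoint from K, two conditions on compact sets that
   persist when f is perturbed.

   For the shift equivalence put A = N \ L and A' = N' \ L'. For n large, the
   middle point of an orbit segment of length 2n in cl A lies in int A', and
   conversely. The connecting map N/L -> N'/L' sends x to f^(3n)(x) when
   f^i(x) is in A for i <= 2n and in A' for n <= i <= 3n, and to the base point
   otherwise. *)

Set Implicit Arguments.
Unset Strict Implicit.
Unset Printing Implicit Defensive.

Import Order.TTheory GRing.Theory Num.Theory.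
Import numFieldNormedType.Exports.

Local Open Scope classical_set_scope.
Local Open Scope ring_scope.
Local Open Scope quotient_scope.

(** * The unit interval, quotients and pasting *)

Lemma comp_continuous (S T U : topologicalType) (f : S -> T) (g : T -> U) :
  continuous f -> continuous g -> continuous (g \o f).
Proof. by move=> cf cg x; apply: continuous_comp; [exact: cf|exact: cg]. Qed.

Lemma pair_continuous (S T U : topologicalType) (f : S -> T) (g : S -> U) :
  continuous f -> continuous g -> continuous (fun x => (f x, g x)).
Proof. by move=> cf cg x; apply: cvg_pair => /=; [exact: cf|exact: cg]. Qed.

Lemma fst_continuous (S T : topologicalType) : continuous (@fst S T).
Proof. by move=> p; exact: cvg_fst. Qed.

Lemma snd_continuous (S T : topologicalType) : continuous (@snd S T).
Proof. by move=> p; exact: cvg_snd. Qed.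

Section unit_interval.
Variable R : realType.

Definition ival (u : unit_itv R) : R := set_val u.

Lemma ival_itv (u : unit_itv R) : 0 <= ival u <= 1.
Proof. by case: u => u iu; exact: (set_mem iu). Qed.

Lemma ival_inj : injective ival.
Proof. by move=> u v uv; apply: val_inj; move: uv. Qed.

Lemma ival_continuous : continuous ival.
Proof. exact: (@initial_continuous (unit_itv R) R set_val). Qed.

Lemma continuous_unit_itv (T : topologicalType) (g : T -> unit_itv R) :
  continuous (ival \o g) -> continuous g.
Proof. exact: continuous_comp_initial. Qed.

Lemma clamp_proof (r : R) : Num.min 1 (Num.max 0 r) \in unit_itv R.
Proof.
by apply: mem_set; rewrite /unit_itv /= le_min le_max lexx ler01 /= ge_min lexx.
Qed.

(** The retraction of the line onto the unit interval. Being total, it lets paths and homotopies be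
    written as real formulas. *)
Definition clamp (r : R) : unit_itv R := 
  exist (fun x => x \in unit_itv R) _ (clamp_proof r).

Lemma ival_clampE r : ival (clamp r) = Num.min 1 (Num.max 0 r).
Proof. by []. Qed.

Lemma ival0 : ival (itv0 R) = 0. Proof. by []. Qed.

Lemma ival1 : ival (itv1 R) = 1. Proof. by []. Qed.

Lemma ival_clamp r : 0 <= r <= 1 -> ival (clamp r) = r.
Proof. by move=> /andP[r0 r1]; rewrite ival_clampE (max_r r0) (min_r r1). Qed.

Lemma clampK (u : unit_itv R) : clamp (ival u) = u.
Proof. by apply: ival_inj; rewrite ival_clamp// ival_itv. Qed.

Lemma clamp_le0 r : r <= 0 -> clamp r = itv0 R.
Proof.
by move=> r0; apply: ival_inj; rewrite ival_clampE ival0 max_l// min_r.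
Qed.

Lemma clamp_ge1 r : 1 <= r -> clamp r = itv1 R.
Proof.
move=> r1; apply: ival_inj; rewrite ival_clampE ival1 max_r ?min_l//.
exact: le_trans r1.
Qed.

Lemma clamp_continuous : continuous clamp.
Proof.
apply: continuous_unit_itv => r.
apply: (@continuous_min R R (cst 1) (fun r => Num.max 0 r)).
  exact: cst_continuous.
by apply: (@continuous_max R R (cst 0) id); [exact: cst_continuous|].
Qed.

Lemma unit_itv_compact : compact [set: unit_itv R].
Proof.
rewrite (_ : setT = clamp @` `[0, 1]); last first.
  apply/seteqP; split=> // u _; exists (ival u); last exact: clampK.
  by rewrite /= in_itv /= ival_itv.
apply: continuous_compact; last exact: segment_compact.
by apply: continuous_subspaceT; exact: clamp_continuous.
Qed.

Lemma unit_itv_hausdorff : hausdorff_space (unit_itv R).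
Proof.
move=> u v uv; apply: ival_inj; apply: Rhausdorff => A B Au Bv.
have [w [Aw Bw]] := uv _ _ (ival_continuous Au) (ival_continuous Bv).
by exists (ival w).
Qed.

Lemma unit_itv_locally_compact : locally_compact [set: unit_itv R].
Proof.
move=> u _; rewrite withinET; exists setT; first exact: filterT.
by split; [exact: unit_itv_compact|exact: closedT].
Qed.

(* Currying makes the product of a quotient map with a locally compact space a
   quotient map. *)
Lemma quotient_prod_continuous (T Z : topologicalType) (Q0 : quotType T)
    (f : quotient_topology Q0 * unit_itv R -> Z) :
  continuous (fun p : T * unit_itv R => f (\pi_(quotient_topology Q0) p.1, p.2)) ->
  continuous f.
Proof.
move=> cf; have [cf1 cf2] := continuous_curry cf.
have -> : f = uncurry (fun q u => f (q, u)) by apply/funext => -[].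
apply: continuous_uncurry; [exact: unit_itv_locally_compact|
  exact: unit_itv_hausdorff| |].
  exact: (proj2 (@quotient_continuous T Q0 {compact-open, unit_itv R -> Z} _)
    cf1).
by move=> q; rewrite -[q]reprK; exact: cf2.
Qed.

(** Pasting along [a <= 0] and [0 <= a]: away from the zeros of [a] a single branch is in force
    nearby, and at a zero both branches tend to the same value. *)
Lemma continuous_if_le0 (T Z : topologicalType) (a : T -> R) (f g : T -> Z) :
  continuous a -> continuous f -> continuous g ->
  (forall x, a x = 0 -> f x = g x) ->
  continuous (fun x => if a x <= 0 then f x else g x).
Proof.
move=> ca cf cg fg x.
have [a0|a0|a0] := ltgtP (a x) 0.
- have near_a : \forall y \near x, a y <= 0.
    by apply: filterS (cvgr_lt _ (ca x) _ a0) => y; exact: ltW.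
  move=> U; rewrite /= (ltW a0) => fU.
  by apply: filterS2 near_a (cf _ _ fU) => y /= ->.
- have near_a : \forall y \near x, (a y <= 0) = false.
    apply: filterS (cvgr_gt _ (ca x) _ a0) => y.
    by rewrite ltNge => /negbTE.
  move=> U; rewrite /= leNgt a0 /= => gU.
  by apply: filterS2 near_a (cg _ _ gU) => y /= ->.
- move=> U; rewrite /= a0 lexx => fU.
  have gU : nbhs (g x) U by rewrite -fg.
  have near_f : \forall y \near x, U (f y) := cf _ _ fU.
  have near_g : \forall y \near x, U (g y) := cg _ _ gU.
  apply: filterS2 near_f near_g => y fy gy /=.
  by case: ifP.
Qed.

End unit_interval.

(** * Homotopies and mapping tori *)

Section homotopy.
Variable R : realType.

Lemma homotopic_trans (P Q : topologicalType) (f g h : P -> Q) :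
  homotopic R f g -> homotopic R g h -> homotopic R f h.
Proof.
move=> [H [cH H0 H1]] [K [cK K0 K1]].
pose a (p : P * unit_itv R) := ival p.2 * 2 - 1.
have c2 : continuous (fun p : P * unit_itv R => ival p.2).
  exact: comp_continuous (@snd_continuous _ _) (@ival_continuous R).
have ca : continuous a.
  move=> p; apply: cvgB; last exact: cvg_cst.
  by apply: cvgM; [exact: c2|exact: cvg_cst].
have cG (G : P * unit_itv R -> Q) (b : P * unit_itv R -> R) : continuous G ->
    continuous b -> continuous (fun p => G (p.1, clamp (b p))).
  move=> cG cb; apply: (comp_continuous _ cG).
  apply: (pair_continuous (@fst_continuous _ _)).
  exact: comp_continuous cb (@clamp_continuous R).
exists (fun p => if a p <= 0 then H (p.1, clamp (ival p.2 * 2))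
                 else K (p.1, clamp (a p))); split.
- apply: continuous_if_le0 => //; [apply: cG => //| exact: cG |].
    by move=> p; apply: cvgM; [exact: c2|exact: cvg_cst].
  move=> p ap0; rewrite ap0 (clamp_le0 (lexx 0)).
  by rewrite clamp_ge1 ?H1 ?K0//; move: ap0; rewrite /a; lra.
- move=> x; rewrite /a /= ival0 mul0r sub0r lerN10.
  by rewrite clamp_le0.
- move=> x; rewrite /a /= ival1 mul1r (_ : 2 - 1 = 1) ?ler10; last by lra.
  by rewrite clamp_ge1.
Qed.

Lemma homotopic_comp (P Q S : topologicalType) (f g : P -> Q)
    (k : Q -> S) (l : S -> P) : continuous k -> continuous l ->
  homotopic R f g -> homotopic R (k \o f \o l) (k \o g \o l).
Proof.
move=> ck cl [H [cH H0 H1]].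
exists (fun p => k (H (l p.1, p.2))); split => [|x|x]; last 2 first.
- by rewrite /= H0.
- by rewrite /= H1.
apply: (comp_continuous _ ck); apply: (comp_continuous _ cH).
apply: (pair_continuous _ (@snd_continuous _ _)).
exact: comp_continuous (@fst_continuous _ _) cl.
Qed.

Lemma homotopy_equivalent_sym (P Q : topologicalType) :
  homotopy_equivalent R P Q -> homotopy_equivalent R Q P.
Proof. by move=> [g [h [cg ch hg gh]]]; exists h, g. Qed.

Lemma homotopy_equivalent_trans (P Q S : topologicalType) :
  homotopy_equivalent R P Q -> homotopy_equivalent R Q S ->
  homotopy_equivalent R P S.
Proof.
move=> [g [h [cg ch hg gh]]] [k [l [ck cl lk kl]]].
exists (k \o g), (h \o l); split.
- by move=> x; apply: continuous_comp; [exact: cg|exact: ck].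
- by move=> x; apply: continuous_comp; [exact: cl|exact: ch].
- apply: homotopic_trans hg.
  exact: (homotopic_comp ch cg lk).
- apply: homotopic_trans kl.
  exact: (homotopic_comp ck cl gh).
Qed.

End homotopy.

Section torus.
Variables (R : realType) (P : topologicalType) (kappa : P -> P).

Local Notation T := (mapping_torus R kappa).

Definition torus_pi (p : P * unit_itv R) : T := \pi_T p.

Lemma torus_pi_continuous : continuous torus_pi.
Proof. exact: pi_continuous. Qed.

Lemma torus_pi_glue x : torus_pi (x, itv1 R) = torus_pi (kappa x, itv0 R).
Proof. by apply/eqmodP/asboolP; apply: rst_step. Qed.

(** Evaluation at the chosen representative; this descends [G] to the mapping torus only when [G]
    respects the gluing. *)
Definition torus_rec (Z : Type) (G : P * unit_itv R -> Z) (q : T) : Z :=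
  G (repr q).

Lemma torus_recE (Z : Type) (G : P * unit_itv R -> Z) :
  (forall x, G (x, itv1 R) = G (kappa x, itv0 R)) ->
  forall p, torus_rec G (torus_pi p) = G p.
Proof.
move=> Gk p; rewrite /torus_rec.
have /eqmodP/asboolP rel_p : \pi_T (repr (torus_pi p)) = torus_pi p :> T.
  by rewrite reprK.
by move: (repr _) rel_p => p'; elim=> [[x u] v [/= -> ->]|u|u v _ ->|u v w _ -> _ ->].
Qed.

Lemma torus_ind (Q : T -> Prop) : (forall p, Q (torus_pi p)) -> forall q, Q q.
Proof. by move=> Qpi q; rewrite -[q]reprK; exact: Qpi. Qed.

Lemma torus_continuous (Z : topologicalType) (g : T -> Z) :
  continuous (g \o torus_pi) -> continuous g.
Proof. by move=> cg; apply/quotient_continuous. Qed.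

(** A homotopy given on the cylinder descends for each fixed time, and jointly continuously because
    the quotient map times the interval is again a quotient map. *)
Lemma torus_homotopic (Z : topologicalType) (g h : T -> Z)
    (G : (P * unit_itv R) * unit_itv R -> Z) :
  continuous G ->
  (forall x u, G ((x, itv1 R), u) = G ((kappa x, itv0 R), u)) ->
  (forall p, G (p, itv0 R) = g (torus_pi p)) ->
  (forall p, G (p, itv1 R) = h (torus_pi p)) ->
  homotopic R g h.
Proof.
move=> cG Gk G0 G1.
have recE u p : torus_rec (fun p => G (p, u)) (torus_pi p) = G (p, u).
  by rewrite torus_recE// => x; rewrite Gk.
exists (fun q => torus_rec (fun p => G (p, q.2)) q.1); split.
- apply: quotient_prod_continuous.
  rewrite (_ : (fun p => _) = G) //.
  by apply/funext => -[p u]; exact: recE.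
- by elim/torus_ind => p; rewrite recE G0.
- by elim/torus_ind => p; rewrite recE G1.
Qed.

End torus.

(** * Mapping tori of shift equivalent maps and of homotopic maps *)

Section torus_map.
Variables (R : realType) (P Q : topologicalType) (kappa : P -> P)
  (lambda : Q -> Q) (r : P -> Q).
Hypotheses (r_cont : continuous r) (r_comm : forall x, r (kappa x) = lambda (r x)).

Definition torus_map : mapping_torus R kappa -> mapping_torus R lambda :=
  torus_rec (fun p => torus_pi lambda (r p.1, p.2)).

Lemma torus_mapE x u : torus_map (torus_pi kappa (x, u)) = torus_pi lambda (r x, u).
Proof. by rewrite /torus_map torus_recE// => y; rewrite /= torus_pi_glue r_comm. Qed.

Lemma torus_map_continuous : continuous torus_map.
Proof.
apply: torus_continuous.
rewrite (_ : _ \o _ = fun p => torus_pi lambda (r p.1, p.2)); last first.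
  by apply/funext => -[x u]; exact: torus_mapE.
apply: (comp_continuous _ (@torus_pi_continuous _ _ _)).
apply: (pair_continuous _ (@snd_continuous _ _)).
exact: comp_continuous (@fst_continuous _ _) r_cont.
Qed.

End torus_map.

Arguments torus_map R {P Q} kappa lambda r q.

Section torus_shift.
Variables (R : realType) (P : topologicalType) (kappa : P -> P).
Hypothesis kappa_cont : continuous kappa.

(* The homotopy moves points along the suspension semiflow. *)
Lemma torus_map_self_homotopic : homotopic R (torus_map R kappa kappa kappa) id.
Proof.
pose ps (p : (P * unit_itv R) * unit_itv R) := ival p.1.2.
pose pu (p : (P * unit_itv R) * unit_itv R) := ival p.2.
have cs : continuous ps.
  apply: (comp_continuous _ (@ival_continuous R)).
  exact: comp_continuous (@fst_continuous _ _) (@snd_continuous _ _).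
have cu : continuous pu.
  exact: comp_continuous (@snd_continuous _ _) (@ival_continuous R).
have cx : continuous (fun p : (P * unit_itv R) * unit_itv R => p.1.1).
  exact: comp_continuous (@fst_continuous _ _) (@fst_continuous _ _).
pose a p := ps p - pu p.
have ca : continuous a by move=> p; apply: cvgB; [exact: cs|exact: cu].
(* At time [u] the point [(x, s)] flows for time [1 - u] and reaches height [s - u + 1]; beyond
   height 1 this is height [s - u] over [kappa x]. *)
pose G p := if a p <= 0 then torus_pi kappa (p.1.1, clamp (a p + 1))
            else torus_pi kappa (kappa p.1.1, clamp (a p)).
have clamp0 : clamp (0 : R) = itv0 R by exact: clamp_le0.
have clamp1 : clamp (1 : R) = itv1 R by exact: clamp_ge1.
apply: (@torus_homotopic _ _ _ _ _ _ G).
- apply: continuous_if_le0 => //.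
  + apply: (comp_continuous _ (@torus_pi_continuous _ _ _)).
    apply: pair_continuous => //; apply: (comp_continuous _ (@clamp_continuous R)).
    by move=> p; apply: cvgD; [exact: ca|exact: cvg_cst].
  + apply: (comp_continuous _ (@torus_pi_continuous _ _ _)).
    apply: pair_continuous; first exact: comp_continuous kappa_cont.
    exact: comp_continuous ca (@clamp_continuous R).
  + by move=> p ap0; rewrite ap0 add0r clamp0 clamp1 torus_pi_glue.
- move=> x u; rewrite /G /a /ps /pu /= ival1 ival0.
  have /andP[u0 u1] := ival_itv u.
  rewrite [in RHS]ifT; last by lra.
  rewrite (_ : 0 - ival u + 1 = 1 - ival u); last by lra.
  case: ifPn => // u1'; have -> : ival u = 1 by lra.
  by rewrite subrr add0r clamp0 clamp1 torus_pi_glue.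
- move=> [x s]; rewrite /G /a /ps /pu /= ival0 subr0 torus_mapE//.
  have /andP[s0 s1] := ival_itv s.
  case: ifPn => [s0'|_]; last by rewrite clampK.
  have -> : s = itv0 R by apply: ival_inj; rewrite ival0; lra.
  by rewrite ival0 add0r clamp1 torus_pi_glue.
- move=> [x s]; rewrite /G /a /ps /pu /= ival1.
  have /andP[s0 s1] := ival_itv s.
  by rewrite subr_le0 s1 subrK clampK.
Qed.

Lemma torus_map_iter_homotopic m :
  homotopic R (torus_map R kappa kappa (iter m kappa)) id.
Proof.
have iter_comm k x : iter k kappa (kappa x) = kappa (iter k kappa x).
  by rewrite -iterSr.
have iter_cont k : continuous (iter k kappa).
  elim: k => [|k IH]; first by move=> x; exact: cvg_id.
  exact: comp_continuous IH kappa_cont.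
elim: m => [|m IH].
  rewrite (_ : torus_map _ _ _ _ = id).
    by exists fst; split => //; exact: fst_continuous.
  by apply/funext; elim/torus_ind => -[x u]; rewrite torus_mapE.
apply: homotopic_trans IH.
rewrite (_ : torus_map R kappa kappa (iter m.+1 kappa) =
   torus_map R kappa kappa (iter m kappa) \o torus_map R kappa kappa kappa \o id).
  rewrite -[X in homotopic _ _ X]/(torus_map R kappa kappa (iter m kappa) \o id \o id).
  apply: homotopic_comp; last exact: torus_map_self_homotopic.
    exact: torus_map_continuous.
  by move=> q; exact: cvg_id.
by apply/funext; elim/torus_ind => -[x u]; rewrite /= !torus_mapE// -iterSr.
Qed.

End torus_shift.

(** The maps of tori induced by [r] and [s] compose to those induced by the [m]-th iterates, which
    are homotopic to the identity. *)
Lemma shift_equivalent_torus (R : realType) (P Q : topologicalType)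
    (kappa : P -> P) (lambda : Q -> Q) (r : P -> Q) (s : Q -> P) m :
  continuous kappa -> continuous lambda -> continuous r -> continuous s ->
  (forall x, r (kappa x) = lambda (r x)) ->
  (forall y, s (lambda y) = kappa (s y)) ->
  (forall x, s (r x) = iter m kappa x) ->
  (forall y, r (s y) = iter m lambda y) ->
  homotopy_equivalent R (mapping_torus R kappa) (mapping_torus R lambda).
Proof.
move=> ck cl cr cs rk sl sr rs.
exists (torus_map R kappa lambda r), (torus_map R lambda kappa s); split.
- exact: torus_map_continuous.
- exact: torus_map_continuous.
- rewrite (_ : _ \o _ = torus_map R kappa kappa (iter m kappa)).
    exact: torus_map_iter_homotopic.
  apply/funext; elim/torus_ind => -[x u].
  by rewrite /= !torus_mapE// ?sr// => y; rewrite -iterSr.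
- rewrite (_ : _ \o _ = torus_map R lambda lambda (iter m lambda)).
    exact: torus_map_iter_homotopic.
  apply/funext; elim/torus_ind => -[x u].
  by rewrite /= !torus_mapE// ?rs// => y; rewrite -iterSr.
Qed.

(** * Mapping tori of homotopic maps *)

Section sweep.
Variables (R : realType) (P : topologicalType) (kappa lambda : P -> P).
Variable (K : P * unit_itv R -> P).
Hypotheses (K_cont : continuous K) (K0 : forall x, K (x, itv0 R) = kappa x)
  (K1 : forall x, K (x, itv1 R) = lambda x).

(* Follow the suspension semiflow of [kappa] for time [a], then, in the fibre
   over [0], follow the homotopy [K] up to time [min (a - 1) h]. *)
Definition sweep x (a h : R) : mapping_torus R kappa :=
  if a - 1 <= 0 then torus_pi kappa (x, clamp a)
  else torus_pi kappa (K (x, clamp (Num.min (a - 1) h)), itv0 R).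

Lemma sweep_continuous (T : topologicalType) (x : T -> P) (a h : T -> R) :
  continuous x -> continuous a -> continuous h ->
  continuous (fun t => sweep (x t) (a t) (h t)).
Proof.
move=> cx ca ch; have ca1 : continuous (fun t => a t - 1).
  by move=> t; apply: cvgB; [exact: ca|exact: cvg_cst].
apply: continuous_if_le0 => //.
- apply: (comp_continuous _ (@torus_pi_continuous _ _ _)).
  by apply: pair_continuous => //; exact: comp_continuous ca (@clamp_continuous R).
- apply: (comp_continuous _ (@torus_pi_continuous _ _ _)).
  apply: pair_continuous; last by move=> t; exact: cvg_cst.
  apply: (comp_continuous _ K_cont); apply: pair_continuous => //.
  apply: (comp_continuous _ (@clamp_continuous R)) => t.
  by apply: (@continuous_min R T (fun t => a t - 1) h); [exact: ca1|exact: ch].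
- move=> t a1; rewrite a1 (@clamp_le0 _ (Num.min 0 _)) ?ge_min ?lexx// K0.
  by rewrite clamp_ge1 ?torus_pi_glue//; lra.
Qed.

(** The first half of the interval runs through the whole fibre interval; the second half carries
    [kappa x] along [K] to [lambda x], as the gluing by [lambda] requires. *)
Definition torus_sweep : mapping_torus R lambda -> mapping_torus R kappa :=
  torus_rec (fun p => sweep p.1 (2 * ival p.2) 1).

Lemma torus_sweepE x u :
  torus_sweep (torus_pi lambda (x, u)) = sweep x (2 * ival u) 1.
Proof.
rewrite /torus_sweep torus_recE//= => y; rewrite ival0 ival1 /sweep.
rewrite mulr0 mulr1 ifF; last by apply/negbTE; rewrite -ltNge; lra.
rewrite ifT; last by lra.
rewrite (clamp_le0 (lexx 0)) clamp_ge1 ?K1//.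
by rewrite le_min lexx andbT; lra.
Qed.

Lemma torus_sweep_continuous : continuous torus_sweep.
Proof.
apply: torus_continuous.
rewrite (_ : _ \o _ = fun p => sweep p.1 (2 * ival p.2) 1); last first.
  by apply/funext => -[x u]; exact: torus_sweepE.
apply: sweep_continuous; first exact: fst_continuous.
  move=> p; apply: cvgM; first exact: cvg_cst.
  exact: (comp_continuous (@snd_continuous _ _) (@ival_continuous R)).
by move=> p; exact: cvg_cst.
Qed.

End sweep.

Arguments torus_sweep {R P} kappa lambda K q.

Definition rev_homotopy (R : realType) (P Q : Type) (K : P * unit_itv R -> Q) :
  P * unit_itv R -> Q := fun p => K (p.1, clamp (1 - ival p.2)).

Lemma rev_homotopyK (R : realType) (P Q : Type) (K : P * unit_itv R -> Q) :
  rev_homotopy (rev_homotopy K) = K.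
Proof.
apply/funext => -[x u]; rewrite /rev_homotopy /=; congr (K (x, _)).
have /andP[u0 u1] := ival_itv u; apply: ival_inj.
by rewrite ival_clamp ival_clamp ?subKr ?u0 ?u1//; apply/andP; split; lra.
Qed.

Lemma rev_homotopy_continuous (R : realType) (P Q : topologicalType)
  (K : P * unit_itv R -> Q) : continuous K -> continuous (rev_homotopy K).
Proof.
move=> cK; apply: (comp_continuous _ cK).
apply: (pair_continuous (@fst_continuous _ _)).
apply: (comp_continuous _ (@clamp_continuous R)) => p.
apply: cvgB; first exact: cvg_cst.
exact: (comp_continuous (@snd_continuous _ _) (@ival_continuous R)).
Qed.

Lemma rev_homotopy0 (R : realType) (P Q : Type) (K : P * unit_itv R -> Q) x :
  rev_homotopy K (x, itv0 R) = K (x, itv1 R).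
Proof. by rewrite /rev_homotopy /= ival0 subr0 clamp_ge1. Qed.

Lemma rev_homotopy1 (R : realType) (P Q : Type) (K : P * unit_itv R -> Q) x :
  rev_homotopy K (x, itv1 R) = K (x, itv0 R).
Proof. by rewrite /rev_homotopy /= ival1 subrr clamp_le0. Qed.

(** The composite crosses the interval at speed 4, climbs [K] at parameter [4 * s - 1] up to
    [s = 1/2], then descends at parameter [2 - 2 * s]. Both phases together are a single [sweep]
    whose height is the minimum of the two parameters. *)
Lemma torus_sweepK (R : realType) (P : topologicalType) (kappa lambda : P -> P)
    (K : P * unit_itv R -> P) :
  continuous K -> (forall x, K (x, itv0 R) = kappa x) ->
  (forall x, K (x, itv1 R) = lambda x) ->
  homotopic R (torus_sweep kappa lambda K \o
               torus_sweep lambda kappa (rev_homotopy K)) id.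
Proof.
move=> cK K0 K1.
pose ps (p : (P * unit_itv R) * unit_itv R) := ival p.1.2.
pose pu (p : (P * unit_itv R) * unit_itv R) := ival p.2.
have cs : continuous ps.
  apply: (comp_continuous _ (@ival_continuous R)).
  exact: comp_continuous (@fst_continuous _ _) (@snd_continuous _ _).
have cu : continuous pu.
  exact: comp_continuous (@snd_continuous _ _) (@ival_continuous R).
(* Slow the flow down from speed 4 to speed 1 while shrinking the excursion
   along [K] to nothing. *)
pose G p := sweep kappa K p.1.1 ((4 - 3 * pu p) * ps p)
  ((1 - pu p) * (2 - 2 * ps p)).
apply: (@torus_homotopic _ _ _ _ _ _ G).
- apply: sweep_continuous => //.
  + exact: comp_continuous (@fst_continuous _ _) (@fst_continuous _ _).
  + move=> p; apply: cvgM; last exact: cs.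
    apply: cvgB; first exact: cvg_cst.
    by apply: cvgM; [exact: cvg_cst|exact: cu].
  + move=> p; apply: cvgM; (apply: cvgB; first exact: cvg_cst); first exact: cu.
    by apply: cvgM; [exact: cvg_cst|exact: cs].
- move=> x u; rewrite /G /ps /pu /= ival0 ival1 /sweep.
  have /andP[u0 u1] := ival_itv u.
  rewrite !mulr0 !mulr1 subrr mulr0 [in RHS]ifT; last by lra.
  rewrite (@clamp_le0 _ 0)//; case: ifPn => u1'.
    by rewrite clamp_ge1 ?torus_pi_glue//; lra.
  by rewrite clamp_le0 ?K0// ge_min lexx orbT.
- move=> [x s]; rewrite /G /ps /pu /= ival0 mulr0 !subr0 mul1r.
  have /andP[s0 s1] := ival_itv s.
  rewrite torus_sweepE//; last by move=> y; rewrite rev_homotopy1 K0.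
  rewrite {2}/sweep; case: ifPn => s2.
    rewrite torus_sweepE//.
    rewrite ival_clamp; last by apply/andP; split; lra.
    rewrite /sweep mulrA -natrM; case: ifPn => // s4.
    by congr (torus_pi kappa (K (x, clamp _), _)); rewrite !min_l//; lra.
  rewrite torus_sweepE// ival0 mulr0 /sweep (ifT (b := 0 - 1 <= 0)); last by lra.
  rewrite ifF; last by apply/negbTE; move: s2; rewrite -!ltNge; lra.
  rewrite (@clamp_le0 _ 0)//; congr (torus_pi kappa (_, _)).
  rewrite /rev_homotopy /=; congr (K (x, clamp _)).
  move: s2; rewrite -ltNge => s2.
  rewrite min_r; last by lra.
  rewrite min_l; last by lra.
  by rewrite ival_clamp; [|apply/andP; split]; lra.
- move=> [x s]; rewrite /G /ps /pu /= ival1 subrr mul0r /sweep.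
  have /andP[s0 s1] := ival_itv s.
  by rewrite (_ : (4 - 3 * 1) * ival s = ival s) ?subr_le0 ?s1 ?clampK//; lra.
Qed.

Lemma homotopic_torus (R : realType) (P : topologicalType) (kappa lambda : P -> P) :
  homotopic R kappa lambda ->
  homotopy_equivalent R (mapping_torus R kappa) (mapping_torus R lambda).
Proof.
move=> [K [cK K0 K1]].
have cK' := rev_homotopy_continuous cK.
have K'0 x : rev_homotopy K (x, itv0 R) = lambda x by rewrite rev_homotopy0.
have K'1 x : rev_homotopy K (x, itv1 R) = kappa x by rewrite rev_homotopy1.
exists (torus_sweep lambda kappa (rev_homotopy K)), (torus_sweep kappa lambda K).
split.
- exact: torus_sweep_continuous.
- exact: torus_sweep_continuous.
- exact: torus_sweepK.
- by have := torus_sweepK cK' K'0 K'1; rewrite rev_homotopyK.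
Qed.

(** * Partial maps between index quotients *)

Section index_class_theory.
Variables (X : topologicalType) (N L : set X).

Local Notation A := (N `\` L).

Lemma index_class_in (y : N) :
  index_class N L (set_val y) = pquot_class (set_val @^-1` L) y.
Proof.
rewrite /index_class; case: insubP => [z _ zy|].
  by congr pquot_class; exact: val_inj.
by rewrite (valP y).
Qed.

(** Outside [N] the default value is the base point, and points of [L] are collapsed to it. *)
Lemma index_class_out x : ~ A x -> index_class N L x = index_base N L.
Proof.
move=> nAx; rewrite /index_class; case: insubP => // y /set_mem Nx yx.
apply/eqmodP/asboolP; right; split => //=.
apply: contrapT => nLy; apply: nAx; split => //.
by move: nLy; rewrite /preimage /= -yx.
Qed.

Lemma index_class_inj x z :
  A x -> index_class N L x = index_class N L z -> x = z.
Proof.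
move=> [Nx nLx]; rewrite /index_class.
case: insubP => [y _ yx|]; last by rewrite mem_set.
case: insubP => [w _ wz|_].
  move=> /eqmodP/asboolP[[yw]|[/= Ly _]]; first by rewrite -yx -wz yw.
  by case: nLx; rewrite -yx.
move=> /eqmodP/asboolP[//|[/= Ly _]].
by case: nLx; rewrite -yx.
Qed.

Lemma index_class_neq_base x : A x -> index_class N L x <> index_base N L.
Proof.
move=> [Nx nLx]; rewrite /index_class.
case: insubP => [y _ yx|]; last by rewrite mem_set.
move=> /eqmodP/asboolP[//|[/= Ly _]].
by case: nLx; rewrite -yx.
Qed.

Lemma index_quot_ind (Q : index_quot N L -> Prop) :
  Q (index_base N L) -> (forall x, A x -> Q (index_class N L x)) ->
  forall q, Q q.
Proof.
move=> Qb Qc q.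
have [y|] := pselect (exists2 y : N, A (set_val y) &
    q = pquot_class (set_val @^-1` L) y).
  by case: y => y Ay ->; rewrite -index_class_in; exact: Qc.
move=> nq; suff -> : q = index_base N L by [].
rewrite -[q]reprK; case qy : (repr q) => [y|] //.
have [Ay|nAy] := pselect (A (set_val y)).
  by case: nq; exists y => //; rewrite -[q]reprK qy.
by rewrite -(index_class_out nAy) index_class_in.
Qed.

(** Unfolds the quotient, added-point and subspace topologies into a condition on points of [X]. The
    added point is isolated and contributes no condition of its own. *)
Lemma open_index_quot (U : set (index_quot N L)) : open U <->
  forall x, N x -> U (index_class N L x) ->
    \forall z \near x, N z -> U (index_class N L z).
Proof.
split=> [oU x Nx Ux|H].
  have : open [set y : N | U (pquot_class (set_val @^-1` L) y)] by exact: oU.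
  move=> [W oW WU]; have Wx : W x.
    have : (set_val @^-1` W) (exist (fun x => x \in N) x (mem_set Nx)).
      by rewrite WU /= -index_class_in.
    by [].
  have : nbhs x W by exact: open_nbhs_nbhs.
  apply: filterS => z Wz Nz.
  have : (set_val @^-1` W) (exist (fun x => x \in N) z (mem_set Nz)) by [].
  by rewrite WU /= -index_class_in.
suff : open [set y : N | U (pquot_class (set_val @^-1` L) y)] by [].
rewrite openE => y /= Uy.
have Ny : N (set_val y) by exact: set_mem (valP y).
have := H _ Ny; rewrite index_class_in => /(_ Uy) near_y.
have : nbhs y (set_val @^-1` [set z | N z -> U (index_class N L z)]).
  exact: (@initial_continuous _ _ set_val).
apply: filterS => z /=; rewrite index_class_in; apply.
exact: set_mem (valP z).
Qed.

Lemma index_base_near (U : set (index_quot N L)) x :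
  closed N -> open U -> ~ A x -> U (index_base N L) ->
  \forall z \near x, U (index_class N L z).
Proof.
move=> cN oU nAx Ub; have [Nx|nNx] := pselect (N x).
  have := iffLR (open_index_quot U) oU x Nx.
  rewrite index_class_out// => /(_ Ub); apply: filterS => z Uz.
  have [/Uz//|nNz] := pselect (N z).
  by rewrite index_class_out// => -[].
have : nbhs x (~` N) by apply: open_nbhs_nbhs; split => //; exact: closed_openC.
by apply: filterS => z nNz; rewrite index_class_out// => -[].
Qed.

End index_class_theory.

Section partial_map.
Variables (X : topologicalType) (N L N' L' : set X).

Local Notation A := (N `\` L).
Local Notation A' := (N' `\` L').

(** Index maps, their iterates and the connecting maps all have this form. The value does not depend
    on the representative as soon as [E] lies in [A]. *)
Definition partial_map (E : set X) (phi : X -> X) (q : index_quot N L) :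
    index_quot N' L' :=
  if (repr q : add_point N) is Some y then
    if `[<E (set_val y)>] then index_class N' L' (phi (set_val y))
    else index_base N' L'
  else index_base N' L'.

Lemma partial_map_base E phi : E `<=` A ->
  partial_map E phi (index_base N L) = index_base N' L'.
Proof.
move=> EA; rewrite /partial_map.
have /eqmodP/asboolP : index_base N L = \pi_(index_quot N L) (repr (index_base N L)).
  by rewrite reprK.
case=> [<-//|[_]]; case: (repr _) => //= z Lz.
by case: ifPn => // /asboolP/EA[].
Qed.

Lemma partial_map_class E phi x : E `<=` A ->
  partial_map E phi (index_class N L x) =
  if `[<E x>] then index_class N' L' (phi x) else index_base N' L'.
Proof.
move=> EA; have [Ax|nAx] := pselect (A x); last first.
  rewrite index_class_out// partial_map_base//.
  by case: ifPn => // /asboolP/EA.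
rewrite /partial_map.
have : index_class N L x = \pi_(index_quot N L) (repr (index_class N L x)).
  by rewrite reprK.
case: (repr _) => [z|].
  by rewrite -[RHS]index_class_in => /(index_class_inj Ax) ->.
by move=> /(index_class_neq_base Ax).
Qed.

End partial_map.

Arguments partial_map {X} N L N' L' E phi q.

(** Composition only intersects domains, so identities between such maps reduce to equalities of
    subsets of [X]. *)
Lemma partial_map_comp (X : topologicalType) (N L N' L' N2 L2 : set X)
    (E E' : set X) (phi phi' : X -> X) q :
  E `<=` N `\` L -> E' `<=` N' `\` L' ->
  partial_map N' L' N2 L2 E' phi' (partial_map N L N' L' E phi q) =
  partial_map N L N2 L2 (E `&` phi @^-1` E') (phi' \o phi) q.
Proof.
move=> EA EA'; have EA2 : E `&` phi @^-1` E' `<=` N `\` L by move=> x [/EA].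
elim/index_quot_ind: q => [|x Ax]; first by rewrite !partial_map_base.
rewrite !partial_map_class//.
case: asboolP => [Ex|nEx]; last first.
  by rewrite partial_map_base// ifF//; apply/asboolP => -[].
rewrite partial_map_class//; congr (if _ then _ else _).
by apply/asboolP/asboolP => [|[]].
Qed.

Lemma partial_map_id (X : topologicalType) (N L : set X) q :
  partial_map N L N L (N `\` L) id q = q.
Proof.
elim/index_quot_ind: q => [|x Ax]; first by rewrite partial_map_base.
by rewrite partial_map_class// ifT//; exact/asboolP.
Qed.

Lemma nbhs_add_point_some (Z : topologicalType) (z : Z) (U : set Z) :
  nbhs z U -> nbhs (Some z : add_point Z) (Some @` U).
Proof.
rewrite nbhsE => -[V [oV Vz] VU]; rewrite nbhsE.
exists (Some @` V); last by move=> _ [w Vw <-]; exists w => //; exact: VU.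
split; last by exists z.
suff : open [set w : Z | (Some @` V : set (add_point Z)) (Some w)] by [].
rewrite (_ : [set w | _] = V)//; apply/seteqP; split => w /=.
  by move=> [v Vv [<-]].
by move=> Vw; exists w.
Qed.

Lemma nbhs_add_point_none (Z : topologicalType) :
  nbhs (None : add_point Z) [set None].
Proof.
rewrite nbhsE; exists [set None] => //; split => //.
suff : open [set w : Z | ([set None] : set (add_point Z)) (Some w)] by [].
by rewrite (_ : [set w | _] = set0); [exact: open0|apply/seteqP; split].
Qed.

Section partial_map_continuous.
Variables (R : realType) (X : topologicalType) (N L N' L' : set X).
Variables (E : set (X * unit_itv R)) (phi : X * unit_itv R -> X).

Local Notation A := (N `\` L).
Local Notation A' := (N' `\` L').

(* A partial map, extended by the base point, is continuous as soon as its domain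
   is relatively clopen in [N] at the points that [phi] sends into [A']. *)
Lemma partial_map_family_continuous : closed N' -> continuous phi ->
  (forall p, E p -> A p.1 /\ A' (phi p)) ->
  (forall p, N p.1 -> A' (phi p) ->
    \forall p' \near p, N p'.1 -> (E p' <-> E p)) ->
  continuous (fun q : index_quot N L * unit_itv R =>
    partial_map N L N' L' (fun x => E (x, q.2)) (fun x => phi (x, q.2)) q.1).
Proof.
move=> cN' cphi EA Eloc.
have EA1 t : (fun x => E (x, t)) `<=` A by move=> x /EA[].
pose h p := if `[<E p>] then index_class N' L' (phi p) else index_base N' L'.
have near_h p (U : set (index_quot N' L')) : open U -> N p.1 -> U (h p) ->
    \forall p' \near p, N p'.1 -> U (h p').
  move=> oU Np; have [A'p|nA'p] := pselect (A' (phi p)).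
    rewrite {1}/h; case: asboolP => [Ep Up|nEp Up].
      have near1 := iffLR (open_index_quot U) oU _ (proj1 A'p) Up.
      have near2 : \forall p' \near p, N' (phi p') -> U (index_class N' L' (phi p')).
        exact: (cphi p _ near1).
      apply: filterS2 near2 (Eloc _ Np A'p) => p' Up' EE Np'.
      have Ep' : E p' by apply/EE.
      by rewrite /h ifT; [apply: Up'; exact: (EA _ Ep').2.1|exact/asboolP].
    apply: filterS (Eloc _ Np A'p) => p' EE Np'.
    by rewrite /h ifF//; apply/asboolP => /EE/nEp.
  (* Here [phi p] is outside [A'], so nearby values lie in [U] whether or not the nearby points
     belong to [E]. *)
  rewrite {1}/h ifF; last by apply/asboolP => /EA[].
  move=> Ub; have near1 := index_base_near cN' oU nA'p Ub.
  have near2 : \forall p' \near p, U (index_class N' L' (phi p')).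
    exact: (cphi p _ near1).
  by apply: filterS near2 => p' Up' _; rewrite /h; case: asboolP.
(* Continuity is checked before passing to the quotient. The added point is isolated and is sent to
   the base point at every time. *)
apply: quotient_prod_continuous; apply/continuousP => U oU.
rewrite openE => -[[y|] t] /= Uyt.
  have hE (z : N) s : partial_map N L N' L' (fun x => E (x, s))
      (fun x => phi (x, s)) (\pi_(index_quot N L) (Some z : add_point N)) =
      h (set_val z, s).
    by rewrite -[\pi_ _ _]index_class_in partial_map_class.
  have Uh : U (h (set_val y, t)) by rewrite -hE.
  have Ny : N (set_val y) by exact: set_mem (valP y).
  have [[B C] /= [By Ct] BC] := near_h (set_val y, t) U oU Ny Uh.
  exists (Some @` (set_val @^-1` B), C) => /=.
    split => //; apply: nbhs_add_point_some.
    exact: (@initial_continuous _ _ set_val).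
  move=> [_ s] /= [[z Bz <-] Cs]; rewrite /= hE.
  by apply: (BC (set_val z, s)) => //=; exact: set_mem (valP z).
exists ([set None], setT) => /=.
  by split; [exact: nbhs_add_point_none|exact: filterT].
move=> [_ s] /= [-> _] /=; move: Uyt.
by rewrite -[\pi_ _ _]/(index_base N L) !partial_map_base.
Qed.

End partial_map_continuous.

Lemma partial_map_continuous (R : realType) (X : topologicalType) (N L N' L' : set X)
    (E : set X) (phi : X -> X) :
  closed N' -> continuous phi ->
  (forall x, E x -> (N `\` L) x /\ (N' `\` L') (phi x)) ->
  (forall x, N x -> (N' `\` L') (phi x) ->
    \forall y \near x, N y -> (E y <-> E x)) ->
  continuous (partial_map N L N' L' E phi).
Proof.
move=> cN' cphi EA Eloc.
have := @partial_map_family_continuous R X N L N' L' (E \o fst) (phi \o fst).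
move=> /(_ cN' (comp_continuous (@fst_continuous _ _) cphi)) H.
rewrite (_ : partial_map _ _ _ _ _ _ = (fun q : index_quot N L * unit_itv R =>
  partial_map N L N' L' E phi q.1) \o (fun q => (q, itv0 R)))//.
apply: comp_continuous.
  apply: pair_continuous; first by move=> q; exact: cvg_id.
  exact: (@cst_continuous _ _ (itv0 R)).
apply: H => [p /EA//|p Np A'p].
exact: (@fst_continuous _ _ p _ (Eloc _ Np A'p)).
Qed.

(** * Local consequences of the continuity of the index map *)

Section index_pair_map_local.
Variables (R : realType) (X : metricType R) (f : X -> X) (N L : set X).
Hypotheses (f_cont : continuous f) (N_cpt : compact N) (L_cpt : compact L)
  (fP_cont : continuous (@index_pair_map X f N L)).

Local Notation A := (N `\` L).

Lemma index_pair_map_partial_map :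
  @index_pair_map X f N L = partial_map N L N L (A `&` f @^-1` A) f.
Proof. by []. Qed.

Let N_closed : closed N.
Proof. exact: compact_closed (@metric_hausdorff _ X) N_cpt. Qed.

Let L_closed : closed L.
Proof. exact: compact_closed (@metric_hausdorff _ X) L_cpt. Qed.

Let DA : A `&` f @^-1` A `<=` A. Proof. by move=> x []. Qed.

Lemma index_pair_map_near x (U : set (index_quot N L)) : N x -> open U ->
  U (partial_map N L N L (A `&` f @^-1` A) f (index_class N L x)) ->
  \forall y \near x, N y ->
    U (partial_map N L N L (A `&` f @^-1` A) f (index_class N L y)).
Proof.
move=> Nx oU Ux; move/continuousP: fP_cont => /(_ U oU) /open_index_quot.
exact.
Qed.

(** The complement of the base point is open because [L] is closed. The index map sends the class of
    [x] into it, hence also the classes of nearby points of [N], and this forces their images into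
    [A]. *)
Lemma index_pair_near x : A x -> A (f x) -> \forall y \near x, N y -> A (f y).
Proof.
move=> Ax Afx; pose U : set (index_quot N L) := [set q | q <> index_base N L].
have oU : open U.
  apply/open_index_quot => y Ny /= Uy.
  have nLy : ~ L y by move=> Ly; apply: Uy; rewrite index_class_out// => -[].
  have : nbhs y (~` L) by apply: open_nbhs_nbhs; split => //; exact: closed_openC.
  by apply: filterS => z nLz Nz; exact: index_class_neq_base.
have Ux : U (partial_map N L N L (A `&` f @^-1` A) f (index_class N L x)).
  rewrite partial_map_class// ifT; last exact/asboolP.
  exact: index_class_neq_base.
apply: filterS (index_pair_map_near (proj1 Ax) oU Ux) => y Uy /Uy.
rewrite /U /= partial_map_class//; case: asboolP => [[]//|_].
by [].
Qed.

(** If [x] were not in [A], its class would go to the base point. Choose a closed neighbourhood of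
    [f x] missing [L]: the classes of its points in [N] form a closed set without the base point,
    yet points of the domain arbitrarily near [x] are sent into it. *)
Lemma index_pair_closure x :
  closure (A `&` f @^-1` A) x -> A (f x) -> A x.
Proof.
move=> cDx Afx; apply: contrapT => nAx.
have Nx : N x by apply: N_closed; apply: closureS cDx => y [[]].
have [B Bfx BL] : exists2 B, nbhs (f x) B & closure B `<=` ~` L.
  have nL : nbhs (f x) (~` L).
    by apply: open_nbhs_nbhs; split; [exact: closed_openC|case: Afx].
  by have [B ? ?] := uniform_regular nL; exists B.
pose U : set (index_quot N L) :=
  [set q | forall z, N z -> closure B z -> q <> index_class N L z].
have AB z : N z -> closure B z -> A z by move=> Nz /BL.
have oU : open U.
  apply/open_index_quot => y Ny Uy.
  have nBy : ~ closure B y by move=> By; exact: (Uy y).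
  have : nbhs y (~` closure B).
    by apply: open_nbhs_nbhs; split => //; exact/closed_openC/closed_closure.
  apply: filterS => z nBz Nz w Nw Bw /esym/(index_class_inj (AB _ Nw Bw)) wz.
  by apply: nBz; rewrite -wz.
have Ux : U (partial_map N L N L (A `&` f @^-1` A) f (index_class N L x)).
  rewrite partial_map_class// ifF; last by apply/asboolP => -[].
  by move=> z Nz Bz /esym; apply: index_class_neq_base; exact: AB.
have nearU := index_pair_map_near Nx oU Ux.
have nearB : \forall y \near x, B (f y) by exact: f_cont.
have [y [Dy [Uy By]]] := cDx _ (filterI nearU nearB).
have := Uy Dy.1.1; rewrite partial_map_class// ifT; last exact/asboolP.
move=> /(_ (f y)); apply => //; first exact: Dy.2.1.
exact: subset_closure.
Qed.

End index_pair_map_local.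

(** * Independence of the index pair *)

Section limit_orbit.
Variables (R : realType) (X : metricType R) (f : X -> X).
Hypothesis f_cont : continuous f.

(* The orbit is a cluster point of the sequence [g] in a power of [W]. *)
Lemma limit_orbit (W C : set X) (g : nat -> int -> X) :
  compact W -> closed C -> (forall n k, W (g n k)) -> (forall n, C (g n 0)) ->
  (forall k (e : R), 0 < e ->
     \forall n \near \oo, ball (f (g n k)) e (g n (k + 1))) ->
  (C `&` inv_set W f) !=set0.
Proof.
move=> Wcpt Ccl Wg Cg orb.
have Pcpt := @tychonoff int (fun=> X) (fun=> W) (fun=> Wcpt).
have [|h [Wh hcl]] := Pcpt (g @ \oo) _; first by exists 0%N => // n _ k; exact: Wg.
have hproj k (V : set X) : nbhs (h k) V ->
    nbhs (h : prod_topology (fun=> X)) [set h' | V (h' k)].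
  by move=> hV; exact: (@proj_continuous int (fun=> X) k h).
have h0 : C (h 0).
  apply: Ccl => V hV.
  have FC : (g @ \oo) [set h' : int -> X | C (h' 0)] by exists 0%N => // n _; exact: Cg.
  by have [h' [Ch' Vh']] := hcl _ _ FC (hproj _ _ hV); exists (h' 0).
exists (h 0); split => //; split; first exact: Wh.
(* The distance from [f (h k)] to [h (k + 1)] is below every [e]: compare with a sequence member
   close to [h] at the coordinates [k] and [k + 1], at a cost of three times [e / 4]. *)
exists h; split => // k; apply: mdist_positivity; apply/eqP.
rewrite eq_le mdist_ge0 andbT; apply/ler_addgt0Pl => e e0.
rewrite addr0; apply: ltW; have e4 : 0 < e / 4 by lra.
have F1 : (g @ \oo) [set h' : int -> X | ball (f (h' k)) (e / 4) (h' (k + 1))].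
  exact: orb.
have N1 := hproj _ _ (nbhsx_ballx (h (k + 1)) _ e4).
have N2 := hproj _ _ (f_cont (nbhsx_ballx (f (h k)) _ e4)).
have N12 := @filterI _ _ (nbhs_filter h) _ _ N1 N2.
have [h' [B1 [B2 B3]]] := hcl _ _ F1 N12.
have := ball_triangle (ball_triangle B3 B1) (ball_sym B2).
by rewrite ballEmdist /= metric_sym => /lt_trans; apply; lra.
Qed.

(** Otherwise arbitrarily long segments in [K] have their middle outside [O]; recentred there, they
    accumulate at a full orbit in [K] through a point outside [O]. *)
Lemma orbit_segment_middle (K O : set X) : compact K -> open O ->
  inv_set K f `<=` O ->
  exists n, forall m, (n <= m)%N -> forall x,
    (forall i, (i <= m.*2)%N -> K (iter i f x)) -> O (iter m f x).
Proof.
move=> Kcpt Oop KO; apply: contrapT => nE.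
have /choice[x xP] n : exists x,
    (forall i, (i <= n.*2)%N -> K (iter i f x)) /\ ~ O (iter n f x).
  apply: contrapT => nx; apply: nE; exists n => m nm x Kx.
  (* A counterexample of length [2m] is trimmed at both ends to length [2n], keeping its middle. *)
  apply: contrapT => nO; apply: nx; exists (iter (m - n) f x).
  split => [i i2n|]; first by rewrite -iterD; apply: Kx; lia.
  by rewrite -iterD subnKC.
(* Time 0 is the middle of the segment. Off the segment the value is frozen at the middle, which is
   harmless because every fixed time is eventually on the segment. *)
pose g n (k : int) : X :=
  if (`|k| <= n)%N then iter `|(k + n%:Z)%R|%N f (x n) else iter n f (x n).
have [||||y [nOy /KO//]] := @limit_orbit K (~` O) g Kcpt.
- exact: open_closedC.
- move=> n k; rewrite /g; case: ifPn => kn; apply (xP n).1; lia.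
- by move=> n; have -> : g n 0 = iter n f (x n); [|exact: (xP n).2].
- move=> k e e0; exists (`|k| + 1)%N => // n /= kn; rewrite /g.
  rewrite ifT; last by lia.
  rewrite ifT; last by lia.
  rewrite (_ : `|(k + 1 + n%:Z)%R|%N = `|(k + n%:Z)%R|.+1)%N; last by lia.
  exact: ballxx.
Qed.

End limit_orbit.

Lemma closure_continuous (S T : topologicalType) (f : S -> T) (B : set S)
    (C : set T) x : continuous f -> B `<=` f @^-1` C ->
  closure B x -> closure C (f x).
Proof.
move=> cf BC cBx V fV; have [y [By Vy]] := cBx _ (cf _ _ fV).
by exists (f y); split => //; exact: BC.
Qed.

Lemma iter_continuous (T : topologicalType) (f : T -> T) n :
  continuous f -> continuous (iter n f).
Proof.
move=> cf; elim: n => [|n IH]; first by move=> x; exact: cvg_id.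
exact: comp_continuous IH cf.
Qed.

Arguments iter_continuous {T f} n cf.

Section index_pair_orbits.
Variables (R : realType) (X : metricType R) (f : X -> X) (S N L : set X).
Hypotheses (f_cont : continuous f) (ip : index_pair S f N L).

Local Notation A := (N `\` L).

Lemma index_pair_closed : closed N /\ closed L.
Proof.
by have [[? ? _] _] := ip; split; apply: compact_closed => //; exact: metric_hausdorff.
Qed.

Lemma index_pair_compact_closure : compact (closure A).
Proof.
have [[Ncpt _ _] _] := ip; apply: (subclosed_compact _ Ncpt).
  exact: closed_closure.
rewrite [X in _ `<=` X](proj1 (closure_id _) (proj1 index_pair_closed)).
by apply: closureS => x [].
Qed.

Lemma orbit_near k x : (forall i, (i <= k)%N -> A (iter i f x)) ->
  \forall y \near x, A y -> forall i, (i <= k)%N -> A (iter i f y).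
Proof.
have [[Ncpt Lcpt LN] [_ _ fP]] := ip.
elim: k => [_|k IH Ax]; first by apply: nearW => y Ay [|//].
have Axk i : (i <= k)%N -> A (iter i f x) by move=> ik; apply: Ax; exact: leqW.
have near_k := index_pair_near Lcpt fP (Axk _ (leqnn k)) (Ax k.+1 (leqnn _)).
have near_k' : \forall y \near x, N (iter k f y) -> A (f (iter k f y)).
  exact: (iter_continuous k f_cont x _ near_k).
apply: filterS2 (IH Axk) near_k' => y Ay Ay' /Ay{}Ay i.
rewrite leq_eqVlt ltnS => /orP[/eqP->|/Ay//].
by apply: Ay'; have [] := Ay _ (leqnn k).
Qed.

(** Membership in [A] is propagated backwards from time [k], one step at a time, by
    [index_pair_closure]. *)
Lemma orbit_closure k x :
  closure [set y | forall i, (i <= k)%N -> A (iter i f y)] x ->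
  A (iter k f x) -> forall i, (i <= k)%N -> A (iter i f x).
Proof.
have [[Ncpt Lcpt LN] [_ _ fP]] := ip.
move=> cx Ak i ik; rewrite -(subKn ik); move: (k - i)%N (leq_subr i k) => {ik}.
elim=> [|j IH] jk; first by rewrite subn0.
have kj : (k - j = (k - j.+1).+1)%N by lia.
have := IH (ltnW jk); rewrite kj => Aj.
apply: (index_pair_closure f_cont Ncpt Lcpt fP _ Aj).
apply: closure_continuous (iter_continuous (k - j.+1) f_cont) _ cx => y Ay.
by split; [apply: Ay|apply: (Ay (k - j.+1).+1)]; lia.
Qed.

Lemma index_pair_map_iter m q : iter m (@index_pair_map X f N L) q =
  partial_map N L N L [set x | forall i, (i <= m)%N -> A (iter i f x)] (iter m f) q.
Proof.
elim: m q => [|m IH] q.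
  rewrite -[LHS](partial_map_id q); congr (partial_map _ _ _ _ _ _ q).
  by apply/seteqP; split => [x Ax [|//]|x /(_ 0 isT)].
rewrite iterS IH index_pair_map_partial_map partial_map_comp; last 2 first.
- by move=> x /(_ 0 isT).
- by move=> x [].
rewrite (_ : f \o iter m f = iter m.+1 f)//.
congr (partial_map _ _ _ _ _ _ q); apply/seteqP; split => [x [Ax [_ Afx]] i|x Ax].
  by rewrite leq_eqVlt ltnS => /orP[/eqP->|/Ax].
split=> [i im|]; first by apply: Ax; exact: leqW.
by split; [exact: (Ax m (leqnSn m))|exact: (Ax m.+1 (leqnn _))].
Qed.

End index_pair_orbits.

(** * Connecting maps and shift equivalence *)

Section connecting_map.
Variables (R : realType) (X : metricType R) (f : X -> X) (S : set X).
Hypothesis f_cont : continuous f.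

(** Two segments of length [2n], the one in [A'] delayed by [n]: the middle of the first is the
    start of the second, and the middle of the second is the end of the first. *)
Definition connecting_dom (N L N' L' : set X) (n : nat) : set X :=
  [set x | (forall i, (i <= n.*2)%N -> (N `\` L) (iter i f x)) /\
           (forall j, (j <= n.*2)%N -> (N' `\` L') (iter (j + n)%N f x))].
Arguments connecting_dom : clear implicits.

Definition connecting_map (N L N' L' : set X) (n : nat) :=
  partial_map N L N' L' (connecting_dom N L N' L' n) (iter (n.*2 + n)%N f).

Arguments connecting_map : clear implicits.

Section one_direction.
Variables (N L N' L' : set X) (n : nat).
Hypotheses (ip : index_pair S f N L) (ip' : index_pair S f N' L').

Local Notation A := (N `\` L).
Local Notation A' := (N' `\` L').

Hypothesis mid : forall x, (forall i, (i <= n.*2)%N -> closure A (iter i f x)) ->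
  interior A' (iter n f x).
Hypothesis mid' : forall x, (forall i, (i <= n.*2)%N -> closure A' (iter i f x)) ->
  interior A (iter n f x).

Lemma connecting_domP x : connecting_dom N L N' L' n x ->
  A x /\ A' (iter (n.*2 + n)%N f x).
Proof. by move=> [Ax A'x]; split; [exact: (Ax 0%N)|exact: A'x]. Qed.

Let midA x : (forall i, (i <= n.*2)%N -> A (iter i f x)) -> A' (iter n f x).
Proof.
by move=> Ax; apply: interior_subset; apply: mid => i /Ax; exact: subset_closure.
Qed.

Let midA' x : (forall i, (i <= n.*2)%N -> A' (iter i f x)) -> A (iter n f x).
Proof.
by move=> Ax; apply: interior_subset; apply: mid' => i /Ax; exact: subset_closure.
Qed.

(** The domain must be relatively clopen at points whose image at time [3n] is in [A']. Openness
    comes from [orbit_near] on both segments, closedness from [orbit_closure]. *)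
Lemma connecting_map_continuous : continuous (connecting_map N L N' L' n).
Proof.
have [Ncl Lcl] := index_pair_closed ip; have [N'cl _] := index_pair_closed ip'.
apply: (@partial_map_continuous R _ _ _ _ _ _ _ N'cl).
- exact: iter_continuous.
- exact: connecting_domP.
move=> x Nx A'x; have [Ex|nEx] := pselect (connecting_dom N L N' L' n x).
  have [Ax A'nx] := Ex.
  have near_A : \forall y \near x, N y -> A y.
    have : nbhs x (~` L).
      by apply: open_nbhs_nbhs; split; [exact: closed_openC|case: (Ax 0%N)].
    by apply: filterS => y nLy Ny.
  (* The interior in [mid] is what keeps the start of the second segment in [A'] for nearby
     points. *)
  have near_A' : \forall y \near x, A' (iter n f y).
    apply: (iter_continuous n f_cont x A').
    by apply: mid => i /Ax; exact: subset_closure.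
  have near_orb := orbit_near f_cont ip Ax.
  have near_orb' : \forall y \near x, A' (iter n f y) ->
      forall j, (j <= n.*2)%N -> A' (iter j f (iter n f y)).
    apply: (iter_continuous n f_cont x [set z | A' z -> forall j,
      (j <= n.*2)%N -> A' (iter j f z)]).
    by apply: (orbit_near f_cont ip') => j /A'nx; rewrite iterD.
  near=> y => Ny; split => // _; split.
    by apply: (near near_orb y _) => //; apply: (near near_A y _).
  move=> j; rewrite iterD; apply: (near near_orb' y _) => //.
  exact: (near near_A' y _).
have [cEx|ncEx] := pselect (closure (connecting_dom N L N' L' n) x); last first.
  have : nbhs x (~` connecting_dom N L N' L' n).
    by rewrite -[nbhs x _]/(interior _ x) interiorC.
  by apply: filterS => y nEy _; split.
exfalso; apply: nEx.
have clA i : (i <= n.*2)%N -> closure A (iter i f x).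
  move=> i2n; apply: closure_continuous (iter_continuous i f_cont) _ cEx.
  by move=> y [Ay _]; exact: Ay.
have clA' j : (j <= n.*2)%N -> closure A' (iter j f (iter n f x)).
  rewrite -iterD => j2n.
  apply: closure_continuous (iter_continuous _ f_cont) _ cEx.
  by move=> y [_ A'y]; exact: A'y.
(* Time [2n] is the middle of the second segment, so [mid'] puts it in [A]; the first segment is
   then recovered backwards from there, and the second from time [3n]. *)
have An : A (iter n.*2 f x).
  by have := interior_subset (mid' clA'); rewrite -iterD addnn.
split; first by apply: (orbit_closure f_cont ip _ An); apply: closureS cEx => y [].
move=> j j2n; rewrite iterD.
apply: (orbit_closure f_cont ip' (k := n.*2)) => //; last by rewrite -iterD.
apply: closure_continuous (iter_continuous n f_cont) _ cEx.
by move=> y [_ A'y] i /A'y; rewrite /= -iterD.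
Unshelve. all: by end_near. Qed.

(** Both sides apply the iterate [3n + 1]. Their domains differ by a shift of one step, and the end
    missing from one segment is supplied as the middle of the other. *)
Lemma connecting_map_comm q :
  connecting_map N L N' L' n (@index_pair_map X f N L q) =
  @index_pair_map X f N' L' (connecting_map N L N' L' n q).
Proof.
rewrite !index_pair_map_partial_map /connecting_map.
rewrite !partial_map_comp; try by [move=> x []|move=> x /connecting_domP[]].
rewrite (_ : iter (n.*2 + n)%N f \o f = f \o iter (n.*2 + n)%N f); last first.
  by apply/funext => x /=; rewrite -iterSr.
congr (partial_map _ _ _ _ _ _ q); apply/seteqP; split => x.
  move=> [[Ax Afx] [Aix A'jx]].
  have Ai i : (i <= n.*2)%N -> A (iter i f x).
    by case: i => [//|i] i2n; rewrite iterSr; apply: Aix; exact: ltnW.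
  have A'j j : (j <= n.*2)%N -> A' (iter (j + n)%N f x).
    case: j => [|j] j2n; first exact: (midA Ai).
    by rewrite addSn iterSr; apply: A'jx; exact: ltnW.
  split; first by [].
  by split; [exact: A'j|rewrite /preimage /= -iterS iterSr; exact: A'jx].
move=> [[Ai A'j] [_ A'fx]].
have A'j1 j : (j <= n.*2)%N -> A' (iter (j + n)%N f (f x)).
  rewrite -iterSr leq_eqVlt => /orP[/eqP->|j2n]; first exact: A'fx.
  exact: (A'j j.+1).
have Ai1 i : (i <= n.*2)%N -> A (iter i f (f x)).
  rewrite leq_eqVlt => /orP[/eqP->|i2n]; last by rewrite -iterSr; exact: Ai.
  rewrite -addnn iterD; apply: midA' => k k2n; rewrite -iterD; exact: A'j1.
by split; split => //; [exact: (Ai 0%N)|exact: (Ai1 0%N)].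
Qed.

(** The composite asks for [A] at times [0..2n] and [4n..6n] and for [A'] at times [n..5n]. Taking
    middles, this is equivalent to [A] at all times [0..6n]. *)
Lemma connecting_mapK q :
  connecting_map N' L' N L n (connecting_map N L N' L' n q) =
  iter (n.*2 + n + (n.*2 + n))%N (@index_pair_map X f N L) q.
Proof.
rewrite index_pair_map_iter// /connecting_map partial_map_comp; last 2 first.
- by move=> x /connecting_domP[].
- by move=> x [Ax _]; exact: (Ax 0%N).
rewrite (_ : iter _ f \o iter _ f = iter (n.*2 + n + (n.*2 + n))%N f); last first.
  by apply/funext => x /=; rewrite -iterD.
congr (partial_map _ _ _ _ _ _ q); apply/seteqP; split => x.
  move=> [[Ai A'j] [A'i Aj]] i i6n.
  have A'k k : (n <= k <= 5 * n)%N -> A' (iter k f x).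
    move=> k5n; have [kn|kn] := leqP k (n.*2 + n).
      by rewrite -(@subnK n k); [apply: A'j; lia|lia].
    rewrite -(@subnK (n.*2 + n) k); last by lia.
    by rewrite iterD; apply: A'i; lia.
  have [i2n|i2n] := leqP i n.*2; first exact: Ai.
  have [i4n|i4n] := leqP (n + (n.*2 + n)) i.
    rewrite -(@subnK (n + (n.*2 + n)) i)// addnA iterD; apply: Aj; lia.
  rewrite -(@subnKC n i); last by lia.
  rewrite iterD; apply: midA' => k k2n; rewrite -iterD; apply: A'k; lia.
move=> Ai; have A'k k : (n <= k <= 5 * n)%N -> A' (iter k f x).
  move=> k5n; rewrite -(@subnKC n k); last by lia.
  rewrite iterD; apply: midA => i i2n; rewrite -iterD; apply: Ai; lia.
split; split => [i i2n|j j2n].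
- by apply: Ai; lia.
- by apply: A'k; lia.
- by rewrite -iterD; apply: A'k; lia.
- by rewrite -iterD; apply: Ai; lia.
Qed.

End one_direction.

Lemma index_pair_torus (N L N' L' : set X) :
  index_pair S f N L -> index_pair S f N' L' ->
  homotopy_equivalent R (mapping_torus R (@index_pair_map X f N L))
    (mapping_torus R (@index_pair_map X f N' L')).
Proof.
move=> ip ip'.
have [_ [invA SA fP]] := ip; have [_ [invA' SA' fP']] := ip'.
(* The invariant set of either closure is [S], which lies in the interior of the other
   difference. *)
have [n1 mid1] := @orbit_segment_middle R X f f_cont _ _
  (index_pair_compact_closure ip) (@open_interior _ (N' `\` L'))
  ltac:(by rewrite invA).
have [n2 mid2] := @orbit_segment_middle R X f f_cont _ _
  (index_pair_compact_closure ip') (@open_interior _ (N `\` L))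
  ltac:(by rewrite invA').
pose n := maxn n1 n2.
have mid := mid1 n (leq_maxl _ _); have mid' := mid2 n (leq_maxr _ _).
apply: (@shift_equivalent_torus R _ _ _ _ (connecting_map N L N' L' n)
  (connecting_map N' L' N L n) (n.*2 + n + (n.*2 + n))) => //.
- exact: connecting_map_continuous.
- exact: connecting_map_continuous.
- exact: connecting_map_comm.
- exact: connecting_map_comm.
- exact: connecting_mapK.
- exact: connecting_mapK.
Qed.

End connecting_map.

(** * Index pairs stable under perturbation *)

Section pseudo_orbits.
Variables (R : realType) (X : metricType R) (f : X -> X) (W : set X).
Hypothesis f_cont : continuous f.

Lemma near_ball_left (x z : X) (e : R) : ball x e z -> \forall y \near x, ball y e z.
Proof.
rewrite ballEmdist /= => xz; have e0 : 0 < e - mdist x z by rewrite subr_gt0.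
apply: filterS (nbhsx_ballx x _ e0) => y; rewrite !ballEmdist /= => xy.
apply: le_lt_trans (metric_triangle y x z) _.
by rewrite (metric_sym y) -ltrBrDr.
Qed.

Lemma near_ball_right (x z : X) (e : R) : ball x e z -> \forall y \near z, ball x e y.
Proof.
by move=> /ball_sym /near_ball_left; apply: filterS => y; exact: ball_sym.
Qed.

(** Indices count backwards: [g k] is the point [k] steps before [x]. *)
Definition pseudo_orbit_to (e : R) : set X :=
  [set x | exists g : nat -> X, [/\ g 0%N = x, forall k, W (g k) &
     forall k, ball (f (g k.+1)) e (g k)]].

Definition pseudo_orbit_from (e : R) : set X :=
  [set x | exists g : nat -> X, [/\ g 0%N = x, forall k, W (g k) &
     forall k, ball (f (g k)) e (g k.+1)]].

Lemma pseudo_orbit_to_cons e x y :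
  pseudo_orbit_to e x -> W y -> ball (f x) e y -> pseudo_orbit_to e y.
Proof.
move=> [g [g0 Wg gb]] Wy xy; exists (fun k => if k is j.+1 then g j else y).
by split => // -[|k] //=; rewrite g0.
Qed.

Lemma pseudo_orbit_from_cons e x y :
  W x -> ball (f x) e y -> pseudo_orbit_from e y -> pseudo_orbit_from e x.
Proof.
move=> Wx xy [g [g0 Wg gb]]; exists (fun k => if k is j.+1 then g j else x).
by split => // -[|k] //=; rewrite g0.
Qed.

Lemma pseudo_orbit_fromS e e' : e <= e' ->
  pseudo_orbit_from e `<=` pseudo_orbit_from e'.
Proof.
move=> ee' x [g [g0 Wg gb]]; exists g; split => // k.
exact: le_ball (gb k).
Qed.

Lemma pseudo_orbit_to_tail e x : pseudo_orbit_to e x ->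
  exists2 y, pseudo_orbit_to e y & ball (f y) e x.
Proof.
move=> [g [<- Wg gb]]; exists (g 1%N); last exact: gb.
by exists (g \o succn); split => // k; [exact: Wg|exact: gb].
Qed.

Lemma pseudo_orbit_from_tail e x : pseudo_orbit_from e x ->
  exists2 y, pseudo_orbit_from e y & ball (f x) e y.
Proof.
move=> [g [<- Wg gb]]; exists (g 1%N); last exact: gb.
by exists (g \o succn); split => // k; [exact: Wg|exact: gb].
Qed.

(** Only the end point is moved, and the last jump stays below [e]. *)
Lemma pseudo_orbit_to_near e x : pseudo_orbit_to e x ->
  \forall y \near x, W y -> pseudo_orbit_to e y.
Proof.
move=> /pseudo_orbit_to_tail[z Pz zx].
apply: filterS (near_ball_right zx) => y zy Wy.
exact: pseudo_orbit_to_cons zy.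
Qed.

Lemma pseudo_orbit_from_near e x : pseudo_orbit_from e x ->
  \forall y \near x, W y -> pseudo_orbit_from e y.
Proof.
move=> /pseudo_orbit_from_tail[z Pz xz].
have : \forall y \near x, ball (f y) e z by exact: (f_cont (near_ball_left xz)).
by apply: filterS => y yz Wy; exact: pseudo_orbit_from_cons yz _.
Qed.

Lemma pseudo_orbit_fromW e x : pseudo_orbit_from e x -> W x.
Proof. by move=> [g [<- Wg _]]. Qed.

Lemma inv_set_pseudo_orbit e x : 0 < e -> inv_set W f x ->
  pseudo_orbit_to e x /\ pseudo_orbit_from e x.
Proof.
move=> e0 [_ [g [Wg <- gf]]]; split.
  exists (fun k => g (- k%:Z)); split => // k.
  rewrite -gf (_ : - k.+1%:Z + 1 = - k%:Z); first exact: ballxx.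
  by rewrite -addn1 PoszD opprD subrK.
exists (fun k => g k%:Z); split => // k.
by rewrite -gf -PoszD addn1; exact: ballxx.
Qed.

Lemma inv_set_image x : inv_set W f x -> inv_set W f (f x).
Proof.
move=> [_ [g [Wg <- gf]]]; split; first by rewrite -gf.
by exists (fun k => g (k + 1)).
Qed.

Hypothesis W_cpt : compact W.
Hypothesis inv_int : inv_set W f `<=` interior W.

(** If this failed for every [e = 1/(n+1)], the full pseudo-orbits through points outside the
    interior would accumulate at a true orbit in [W] through such a point. *)
Lemma pseudo_orbits_interior : exists2 e : R, 0 < e &
  pseudo_orbit_to e `&` pseudo_orbit_from e `<=` interior W.
Proof.
apply: contrapT => nE.
have /choice[g gP] (n : nat) : exists g : int -> X,
    [/\ forall k, W (g k), ~ interior W (g 0) &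
        forall k, ball (f (g k)) n.+1%:R^-1 (g (k + 1))].
  apply: contrapT => ng; apply: nE; exists n.+1%:R^-1; first by rewrite invr_gt0.
  move=> x [[a [a0 Wa ab]] [b [b0 Wb bb]]]; apply: contrapT => nx; apply: ng.
  (* [Negz i] is [-(i + 1)], so the backward half starts at [a 1]; the point [a 0 = b 0] is taken
     from [b]. *)
  exists (fun k => match k with Posz i => b i | Negz i => a i.+1 end).
  split => [[i|i]//||[i|[|i]]] /=.
  - by rewrite b0.
  - by rewrite addn1; exact: bb.
  - by rewrite b0 -a0; exact: ab.
  - by rewrite subn1 /=; exact: ab.
have [||||x [nx /inv_int]//] := @limit_orbit R X f f_cont W (~` interior W) g W_cpt.
- by apply: open_closedC; exact: open_interior.
- by move=> n k; have [] := gP n.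
- by move=> n; have [] := gP n.
- move=> k e e0; apply: filterS (near_infty_natSinv_lt (PosNum e0)) => n /= ne.
  by have [_ _ /(_ k)] := gP n; exact/le_ball/ltW.
Qed.

End pseudo_orbits.

Definition robust_pair (X : topologicalType) (f : X -> X) (N L : set X) :=
  (forall x, closure (N `\` L) x -> interior N (f x)) /\
  (forall x, L x -> ~ closure (N `\` L) (f x)).

Lemma robust_pair_exists (R : realType) (X : metricType R) (f : X -> X) (W : set X) :
  continuous f -> compact W -> inv_set W f `<=` interior W ->
  exists N L, [/\ compact N, compact L, L `<=` N, N `<=` W &
    inv_set W f `<=` interior (N `\` L) /\ robust_pair f N L].
Proof.
move=> f_cont W_cpt inv_int.
have Wcl : closed W by apply: compact_closed => //; exact: metric_hausdorff.
have [e e0 eW] := pseudo_orbits_interior f_cont W_cpt inv_int.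
have d0 : 0 < e / 2 by rewrite divr_gt0.
have de : e / 2 <= e by lra.
pose C1 := pseudo_orbit_to f W e `&` pseudo_orbit_from f W e.
pose C2 := pseudo_orbit_to f W e `&` pseudo_orbit_from f W (e / 2).
have C21 : C2 `<=` C1 by move=> x [? ?]; split => //; exact: pseudo_orbit_fromS de _ _.
(* For [d <= e] the set lies in the interior of [W], so openness relative to [W] is openness in
   [X]. *)
have C_open d : d <= e -> open (pseudo_orbit_to f W e `&` pseudo_orbit_from f W d).
  move=> lede; rewrite openE => x [Px Qx].
  have Wx : nbhs x W by apply: eW; split => //; exact: pseudo_orbit_fromS lede _ Qx.
  apply: filterS3 Wx (pseudo_orbit_to_near Px) (pseudo_orbit_from_near f_cont Qx).
  by move=> y Wy Py Qy; split; [exact: Py|exact: Qy].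
have C1o : open C1 := C_open e (lexx e).
have C2o : open C2 := C_open (e / 2) de.
pose N := closure C1; pose L := N `&` f @^-1` (~` C2).
have NW : N `<=` W.
  move=> x Nx; apply: Wcl; apply: closureS Nx => y [_]; exact: pseudo_orbit_fromW.
have Ncpt : compact N.
  by apply: (subclosed_compact _ W_cpt) => //; exact: closed_closure.
have Lcpt : compact L.
  apply: compact_closedI => //; apply: preimage_closed => //.
  exact: open_closedC.
have NLC x : (N `\` L) x -> C2 (f x).
  by move=> [Nx nLx]; apply: contrapT => nC; apply: nLx.
have near_ff x d : 0 < d -> \forall y \near f x, ball (f (f x)) d (f y).
  move=> d_gt0; exact: (f_cont (f x) _ (nbhsx_ballx (f (f x)) d d_gt0)).
(* Some [y] in [C1] has [f y] within [e] of [f x]; its backward pseudo-orbit is prolonged by the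
   jump to [f x]. *)
have NP x : N x -> W (f x) -> pseudo_orbit_to f W e (f x).
  move=> Nx Wfx.
  have : nbhs x (f @^-1` ball (f x) e) by exact: (f_cont x _ (nbhsx_ballx (f x) e e0)).
  move=> /Nx[y [[Py _] xy]]; apply: pseudo_orbit_to_cons Py Wfx _.
  exact: ball_sym.
have KN x : closure (N `\` L) x -> N x.
  by move=> Kx; apply: (@closed_closure _ C1); apply: closureS Kx => y [].
exists N, L; split => //; first by move=> x [].
split.
  move=> x invx.
  have C1x : C1 x by have [] := inv_set_pseudo_orbit e0 invx.
  have C2fx : C2 (f x).
    have invfx := inv_set_image invx; split.
      by have [] := inv_set_pseudo_orbit e0 invfx.
    by have [] := inv_set_pseudo_orbit d0 invfx.
  have n1 : nbhs x C1 by exact: open_nbhs_nbhs.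
  have n2 : nbhs x (f @^-1` C2) by apply: f_cont; exact: open_nbhs_nbhs.
  apply: filterS2 n1 n2 => y C1y C2fy; split; first exact: subset_closure.
  by move=> [_]; exact.
split=> [x Kx|x [Nx nC2] Kfx].
  have clC2 : closure C2 (f x) by apply: closure_continuous f_cont NLC Kx.
  have Wfx : W (f x).
    by apply: NW; apply: closureS clC2.
  have C1fx : C1 (f x).
    split; first exact: NP (KN _ Kx) Wfx.
    (* A point [z] of [C2] near [f x] has [f z] within [e / 2] of [f (f x)], and its forward jump
       costs another [e / 2]; so [f x] starts an [e]-pseudo-orbit. *)
    have [z [[_ Qz] xz]] := clC2 _ (near_ff x _ d0).
    have [w Qw zw] := pseudo_orbit_from_tail Qz.
    apply: pseudo_orbit_from_cons Wfx _ (pseudo_orbit_fromS de Qw).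
    by rewrite (splitr e); exact: ball_triangle xz zw.
  have : nbhs (f x) C1 by exact: open_nbhs_nbhs.
  by apply: filterS; exact: subset_closure.
have Wfx : W (f x) by apply: NW; exact: KN.
apply: nC2; split; first exact: NP.
(* Now [f y] itself is in [C2], so the jump from [f x] to [f y] costs only [e / 2]. This puts [f x]
   in [C2], against [x] being in [L]. *)
have [y [Ay xy]] := Kfx _ (near_ff x _ d0).
have [_ Qy] := NLC _ Ay.
exact: pseudo_orbit_from_cons Wfx xy Qy.
Qed.

(** * Index maps of robust pairs *)

Section robust.
Variables (R : realType) (X : metricType R) (N L : set X).
Hypotheses (N_cpt : compact N) (L_cpt : compact L).

Local Notation A := (N `\` L).

Let N_closed : closed N.
Proof. exact: compact_closed (@metric_hausdorff _ X) N_cpt. Qed.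

Let L_closed : closed L.
Proof. exact: compact_closed (@metric_hausdorff _ X) L_cpt. Qed.

(** If [x] in [N] has its image in [A], the second robustness condition puts [x] in [A]. Avoiding
    [L] is an open condition and the first robustness condition keeps images of [A] in [N], so near
    such a point the domain is all of [N]. *)
Lemma robust_pair_family_continuous (phi : X * unit_itv R -> X) :
  continuous phi ->
  (forall t, robust_pair (fun x => phi (x, t)) N L) ->
  continuous (fun q : index_quot N L * unit_itv R =>
    @index_pair_map X (fun x => phi (x, q.2)) N L q.1).
Proof.
move=> cphi rob.
apply: (@partial_map_family_continuous R X N L N L
  [set p | A p.1 /\ A (phi p)] phi N_closed cphi) => [p //|[x t] Nx Aphi].
have Ax : A x.
  split=> // Lx; apply: (rob t).2 Lx _; exact: subset_closure.
have near_L : \forall p \near (x, t), ~ L p.1.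
  apply: (@fst_continuous _ _ (x, t) (~` L)).
  by apply: open_nbhs_nbhs; split; [exact: closed_openC|case: Ax].
have near_phi : \forall p \near (x, t), ~ L (phi p).
  apply: (cphi (x, t) (~` L)).
  by apply: open_nbhs_nbhs; split; [exact: closed_openC|case: Aphi].
apply: filterS2 near_L near_phi => -[y s] /= nLy nLphi Ny.
split => // _; split => //; split => //.
by apply: interior_subset; apply: (rob s).1; exact: subset_closure.
Qed.

Lemma robust_pair_homotopic (phi : X * unit_itv R -> X) :
  continuous phi ->
  (forall t, robust_pair (fun x => phi (x, t)) N L) ->
  homotopic R (@index_pair_map X (fun x => phi (x, itv0 R)) N L)
    (@index_pair_map X (fun x => phi (x, itv1 R)) N L).
Proof.
move=> cphi rob; exists (fun q : index_quot N L * unit_itv R =>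
    @index_pair_map X (fun x => phi (x, q.2)) N L q.1).
by split => //; exact: robust_pair_family_continuous.
Qed.

Lemma robust_pair_index_pair (f : X -> X) (S : set X) : L `<=` N ->
  continuous f -> robust_pair f N L ->
  inv_set (closure A) f = S -> S `<=` interior A -> index_pair S f N L.
Proof.
move=> LN cf rob invS SA; split; split => //.
apply: (comp_continuous (f := fun q : index_quot N L => (q, itv0 R))
  (g := fun q : index_quot N L * unit_itv R => @index_pair_map X f N L q.1)).
  apply: pair_continuous; first by move=> q; exact: cvg_id.
  exact: (@cst_continuous _ _ (itv0 R)).
apply: (@robust_pair_family_continuous (f \o fst)) => //.
exact: comp_continuous (@fst_continuous _ _) cf.
Qed.

End robust.

(** * Continuation *)

(** Otherwise the sets [S] minus [B], with [Q B], generate a proper filter; a cluster point of it in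
    [S] contradicts the local hypothesis. *)
Lemma compact_induction (T : topologicalType) (S : set T) (Q : set T -> Prop) :
  compact S -> Q set0 -> (forall A B, A `<=` B -> Q B -> Q A) ->
  (forall A B, Q A -> Q B -> Q (A `|` B)) ->
  (forall x, S x -> exists2 B, nbhs x B & Q B) -> Q S.
Proof.
move=> Scpt Q0 QS QU Qloc; apply: contrapT => nQS.
pose F := filter_from Q (fun B => S `\` B).
have FF : ProperFilter F.
  apply: filter_from_proper; last first.
    move=> B QB; apply: contrapT => SB0; apply: nQS; apply: QS QB => x Sx.
    by apply: contrapT => nBx; apply: SB0; exists x.
  apply: filter_from_filter; first by exists set0.
  by move=> A B QA QB; exists (A `|` B); [exact: QU|rewrite setDUr].
have FS : F S by exists set0 => //; rewrite setD0.
have [x [Sx clx]] := Scpt F FF FS; have [B xB QB] := Qloc x Sx.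
have FB : F (S `\` B) by exists B.
by have [y [[_ nBy] By]] := clx _ _ FB xB.
Qed.

Section invariant_sets.
Variables (X : Type) (f : X -> X).

Lemma inv_set_subset (A B : set X) : A `<=` B -> inv_set A f `<=` inv_set B f.
Proof.
move=> AB x [Ax [g [Ag g0 gf]]]; split; first exact: AB.
by exists g; split => // n; exact: AB.
Qed.

Lemma inv_set_orbit (A : set X) (g : int -> X) :
  (forall n, A (g n)) -> (forall n, g (n + 1) = f (g n)) ->
  forall n, inv_set A f (g n).
Proof.
move=> Ag gf n; split => //; exists (fun k => g (n + k)).
by split => [k||k]; rewrite ?addr0 ?addrA.
Qed.

End invariant_sets.

Section continuation.
Variables (R : realType) (X : metricType R) (S_ : unit_itv R -> set X)
  (f_ : unit_itv R -> X -> X).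
Hypothesis X_lc : locally_compact [set: X].

Let F (p : X * unit_itv R) := (f_ p.2 p.1, p.2).
Let Sigma : set (X * unit_itv R) := [set p | S_ p.2 p.1].

Hypothesis F_cont : continuous F.
Hypothesis Sigma_isol : isolated_invariant Sigma F.

Let phi_cont : continuous (fun p : X * unit_itv R => f_ p.2 p.1).
Proof. exact: comp_continuous F_cont (@fst_continuous _ _). Qed.

Lemma slice_map_continuous t : continuous (f_ t).
Proof.
apply: (comp_continuous (f := fun x => (x, t))
  (g := fun p : X * unit_itv R => f_ p.2 p.1)) => //.
apply: pair_continuous; first by move=> q; exact: cvg_id.
exact: (@cst_continuous _ _ t).
Qed.

Lemma slice_compact t : compact (S_ t).
Proof.
have [Scpt _] := Sigma_isol.
have -> : S_ t = fst @` (Sigma `&` [set p | p.2 = t]).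
  apply/seteqP; split => [x Sx|x [[y s] [/= Sy <-] <-]//].
  by exists (x, t).
apply: continuous_compact.
  by apply: continuous_subspaceT; exact: fst_continuous.
apply: compact_closedI => //.
apply: (@preimage_closed _ _ snd [set t]) => [p _|]; first exact: snd_continuous.
apply: compact_closed; [exact: unit_itv_hausdorff|exact: compact_set1].
Qed.

(** The part of [Sigma] lying over the complement of [O] is compact and misses the level [t], hence
    misses all nearby levels. *)
Lemma slice_near t (O : set X) : open O -> S_ t `<=` O ->
  \forall s \near t, S_ s `<=` O.
Proof.
move=> Oop StO; have [Scpt _] := Sigma_isol.
have Ocpt : compact (Sigma `&` [set p | ~ O p.1]).
  apply: compact_closedI => //.
  apply: (@preimage_closed _ _ fst (~` O)) => [p _|]; first exact: fst_continuous.
  exact: open_closedC.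
have near_t : \forall s \near t, Sigma `&` [set p | ~ O p.1] `<=` [set p | p.2 <> s].
  apply: (proj1 (compact_near_coveringP _) Ocpt _ (nbhs t) (fun s p => p.2 <> s)).
  move=> [x u] [/= Sx nOx].
  have ut : u <> t by move=> ut; apply: nOx; apply: StO; rewrite -ut.
  have [[A B] /= [Au Bt] [oA oB AB0]] : exists2 AB : set (unit_itv R) * set (unit_itv R),
      u \in AB.1 /\ t \in AB.2 & [/\ open AB.1, open AB.2 & AB.1 `&` AB.2 == set0].
    have := @unit_itv_hausdorff R; rewrite open_hausdorff => H.
    have [|AB [? ?] ?] := H u t; first exact/eqP.
    by exists AB.
  exists ([set p | A p.2], B) => /=.
    split; last by apply: open_nbhs_nbhs; split => //; exact: set_mem.
    apply: (@snd_continuous _ _ (x, u) A); apply: open_nbhs_nbhs.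
    by split => //; exact: set_mem.
  move=> [[y v] s] /= [Av Bs] vs.
  have : (A `&` B) v by split => //; rewrite vs.
  by rewrite (eqP AB0).
apply: filterS near_t => s Ss x Sx; apply: contrapT => nOx.
exact: (Ss (x, s)).
Qed.

(** [F] preserves the parameter, so a full orbit in [Sigma] through level [t] stays at that
    level. *)
Lemma slice_orbit t x : S_ t x -> exists g : int -> X,
  [/\ forall n, S_ t (g n), g 0 = x & forall n, g (n + 1) = f_ t (g n)].
Proof.
move=> Stx; have [_ [M [_ invM]]] := Sigma_isol.
have : Sigma (x, t) by [].
rewrite -invM => -[_ [g [Mg g0 gF]]].
have g2 n : (g n).2 = t.
  have gS k : (g (k + 1)).2 = (g k).2 by rewrite gF.
  elim/int_rect: n => [|n IH|n IH]; first by rewrite g0.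
    by rewrite -addn1 PoszD gS.
  by rewrite -[LHS]gS -addn1 PoszD opprD subrK.
have Sg n : Sigma (g n) by rewrite -invM; exact: inv_set_orbit.
exists (fun n => (g n).1); split => [n||n].
- by have := Sg n; rewrite /Sigma /= g2.
- by rewrite g0.
- by rewrite gF /= g2.
Qed.

Lemma slice_inv_set t (B : set X) : S_ t `<=` B -> S_ t `<=` inv_set B (f_ t).
Proof.
move=> SB x /slice_orbit[g [Sg g0 gf]]; split.
  by rewrite -g0; exact: SB.
by exists g; split => // n; exact: SB.
Qed.

(** Finitely many compact neighbourhoods cover the slice, each lying in [M] at all levels near [t].
    An orbit of [f_ s] in their union is then an orbit of [F] in [M], hence in [Sigma]. *)
Lemma isolating_nbhd_exists (t : unit_itv R) : exists W, [/\ compact W, S_ t `<=` interior W &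
  \forall s \near t, inv_set W (f_ s) `<=` S_ s].
Proof.
have [_ [M [SM invM]]] := Sigma_isol.
have [W [Wcpt SW WM]] : exists W, [/\ compact W, S_ t `<=` interior W &
    \forall s \near t, forall x, W x -> M (x, s)].
  pose Q (B : set X) := exists W, [/\ compact W, B `<=` interior W &
    \forall s \near t, forall x, W x -> M (x, s)].
  suff : Q (S_ t) by [].
  apply: (compact_induction (@slice_compact t)).
  - exists set0; split => //; first exact: compact0.
    have : nbhs t setT by exact: filterT.
    by apply: filterS => s _ x.
  - move=> A B AB [W [Wcpt BW WM]]; exists W; split => //.
    exact: subset_trans BW.
  - move=> A B [V [Vcpt AV VM]] [W [Wcpt BW WM]]; exists (V `|` W); split.
    + exact: compactU.
    + apply: subset_trans (@interiorU _ V W); exact: setUSS.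
    + by apply: filterS2 VM WM => s VM WM x [/VM|/WM].
  - move=> x Sx; have [[B J] /= [Bx Jt] BJ] : nbhs (x, t) M by exact: SM.
    have [U] := @X_lc x I; rewrite withinET => Ux [Ucpt Ucl].
    have [V Vx VB] : exists2 V, nbhs x V & closure V `<=` B.
      by have [V ? ?] := uniform_regular Bx; exists V.
    exists (interior (U `&` closure V)).
      apply: nbhs_interior; apply: filterI => //.
      by apply: filterS Vx; exact: subset_closure.
    exists (U `&` closure V); split => //.
      by apply: compact_closedI => //; exact: closed_closure.
    by apply: filterS Jt => s Js y [_ Vy]; apply: (BJ (y, s)); split => //; exact: VB.
exists W; split => //; apply: filterS WM => s WM x [Wx [g [Wg g0 gf]]].
suff : Sigma (x, s) by [].
rewrite -invM; split; first exact: WM.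
exists (fun n => (g n, s)); split => [n||n]; first exact: WM.
  by rewrite g0.
by rewrite /F /= gf.
Qed.

Lemma robust_pair_near t (N L : set X) : compact N -> compact L ->
  robust_pair (f_ t) N L -> \forall s \near t, robust_pair (f_ s) N L.
Proof.
move=> Ncpt Lcpt [robN robL].
have Ncl : closed N by apply: compact_closed => //; exact: metric_hausdorff.
have Kcpt : compact (closure (N `\` L)).
  apply: (subclosed_compact _ Ncpt); first exact: closed_closure.
  by move=> x Kx; apply: Ncl; apply: closureS Kx => y [].
have near_open (C O : set X) : compact C -> open O -> C `<=` f_ t @^-1` O ->
    \forall s \near t, C `<=` f_ s @^-1` O.
  move=> Ccpt Oop CO.
  apply: (proj1 (compact_near_coveringP _) Ccpt _ (nbhs t) (fun s x => O (f_ s x))).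
  move=> x Cx; apply: (@phi_cont (x, t) O); apply: open_nbhs_nbhs.
  by split => //; exact: CO.
have near1 := near_open _ _ Kcpt (@open_interior _ N) robN.
have near2 := near_open _ (~` closure (N `\` L)) Lcpt
  (closed_openC (@closed_closure _ _)) robL.
by apply: filterS2 near1 near2 => s rob1 rob2; split.
Qed.

(** A robust pair for [f_ t] inside the isolating [W] stays robust for [s] near [t]. The invariant
    set of [closure (N \ L)] is squeezed: it lies in that of [W], hence in [S_ s], and contains
    [S_ s] because the slice stays in the interior of [N \ L]. *)
Lemma common_index_pair (t : unit_itv R) : exists N L, [/\ compact N, compact L, L `<=` N &
  \forall s \near t, robust_pair (f_ s) N L /\ index_pair (S_ s) (f_ s) N L].
Proof.
have [W [Wcpt SW invW]] := isolating_nbhd_exists t.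
have inv_int : inv_set W (f_ t) `<=` interior W.
  by apply: subset_trans SW; exact: nbhs_singleton invW.
have [N [L [Ncpt Lcpt LN NW [invNL rob]]]] :=
  robust_pair_exists (slice_map_continuous (t := t)) Wcpt inv_int.
exists N, L; split => //.
have SNL : S_ t `<=` interior (N `\` L).
  apply: subset_trans invNL; apply: slice_inv_set.
  by apply: subset_trans SW _; exact: interior_subset.
have Ncl : closed N by apply: compact_closed => //; exact: metric_hausdorff.
apply: filterS3 (robust_pair_near Ncpt Lcpt rob)
  (slice_near (@open_interior _ _) SNL) invW => s robs SNLs invWs.
split => //; apply: robust_pair_index_pair => //; first exact: slice_map_continuous.
apply/seteqP; split.
  apply: subset_trans invWs; apply: inv_set_subset => x Kx.
  by apply: NW; apply: Ncl; apply: closureS Kx => y [].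
apply: slice_inv_set; apply: subset_trans SNLs _.
by apply: subset_trans (@interior_subset _ _) _; exact: subset_closure.
Qed.

(** Existence of index pairs is part of the relation: transitivity passes through a pair at the
    middle parameter. *)
Definition same_index (s t : unit_itv R) :=
  [/\ exists N L, index_pair (S_ s) (f_ s) N L,
      exists N L, index_pair (S_ t) (f_ t) N L &
      forall N L N' L', index_pair (S_ s) (f_ s) N L ->
        index_pair (S_ t) (f_ t) N' L' ->
        homotopy_equivalent R (mapping_torus R (@index_pair_map X (f_ s) N L))
          (mapping_torus R (@index_pair_map X (f_ t) N' L'))].

Lemma same_index_sym s t : same_index s t -> same_index t s.
Proof.
move=> [es et he]; split => // N L N' L' ip ip'.
by apply: homotopy_equivalent_sym; exact: he.
Qed.

Lemma same_index_trans s t u : same_index s t -> same_index t u -> same_index s u.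
Proof.
move=> [es [N [L ip]] he] [_ eu he']; split => // N1 L1 N2 L2 ip1 ip2.
exact: homotopy_equivalent_trans (he _ _ _ _ ip1 ip) (he' _ _ _ _ ip ip2).
Qed.

Lemma same_index_near (t : unit_itv R) : \forall s \near t, same_index t s.
Proof.
have [N [L [Ncpt Lcpt LN near_ip]]] := common_index_pair t.
pose path (s u : unit_itv R) := clamp (ival t + ival u * (ival s - ival t)).
have path0 s : path s (itv0 R) = t by rewrite /path ival0 mul0r addr0 clampK.
have path1 s : path s (itv1 R) = s by rewrite /path ival1 mul1r addrC subrK clampK.
have path_cont : continuous (fun p : unit_itv R * unit_itv R => path p.1 p.2).
  apply: (comp_continuous _ (@clamp_continuous R)) => p.
  apply: cvgD; first exact: cvg_cst.
  apply: cvgM; first exact: (comp_continuous (@snd_continuous _ _) (@ival_continuous R)).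
  apply: cvgB; last exact: cvg_cst.
  exact: (comp_continuous (@fst_continuous _ _) (@ival_continuous R)).
(* Each [path t u] equals [t], so near each [u] the pair is good for all [s] close to [t];
   compactness of the interval makes this uniform in [u]. *)
have near_path : \forall s \near t, [set: unit_itv R] `<=`
    [set u | robust_pair (f_ (path s u)) N L /\
             index_pair (S_ (path s u)) (f_ (path s u)) N L].
  apply: (proj1 (compact_near_coveringP _) (@unit_itv_compact R) _ (nbhs t)
    (fun s u => robust_pair (f_ (path s u)) N L /\
                index_pair (S_ (path s u)) (f_ (path s u)) N L)) => u _.
  have pu : path t u = t by rewrite /path subrr mulr0 addr0 clampK.
  have swap_path_cont : continuous
      (fun p : unit_itv R * unit_itv R => path p.2 p.1).
    apply: (comp_continuous (f := fun p : unit_itv R * unit_itv R => (p.2, p.1))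
      (g := fun p : unit_itv R * unit_itv R => path p.1 p.2)) => //.
    exact: pair_continuous (@snd_continuous _ _) (@fst_continuous _ _).
  apply: (swap_path_cont (u, t) [set s | robust_pair (f_ s) N L /\
    index_pair (S_ s) (f_ s) N L]).
  by rewrite /= pu.
apply: filterS near_path => s robs.
have ips : index_pair (S_ s) (f_ s) N L.
  by have [_] := robs (itv1 R) I; rewrite path1.
have ipt : index_pair (S_ t) (f_ t) N L.
  by have [_] := robs (itv0 R) I; rewrite path0.
have he : homotopy_equivalent R (mapping_torus R (@index_pair_map X (f_ t) N L))
    (mapping_torus R (@index_pair_map X (f_ s) N L)).
  apply: homotopic_torus.
  have := @robust_pair_homotopic R X N L Ncpt Lcpt (fun p => f_ (path s p.2) p.1).
  rewrite /= path0 path1; apply; last by move=> u; have [] := robs u I.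
  apply: (comp_continuous (f := fun p : X * unit_itv R => (p.1, path s p.2))
    (g := fun p : X * unit_itv R => f_ p.2 p.1)) => //.
  apply: (pair_continuous (@fst_continuous _ _)).
  apply: (comp_continuous (f := fun p : X * unit_itv R => (s, p.2))
    (g := fun p : unit_itv R * unit_itv R => path p.1 p.2)) => //.
  exact: pair_continuous (@cst_continuous _ _ s) (@snd_continuous _ _).
split; [by exists N, L|by exists N, L|move=> N1 L1 N2 L2 ip1 ip2].
apply: homotopy_equivalent_trans (index_pair_torus (slice_map_continuous (t := t)) ip1 ipt) _.
apply: homotopy_equivalent_trans he _.
exact: (index_pair_torus (slice_map_continuous (t := s)) ips ip2).
Qed.

(** The class of parameter 0 is open by local constancy, and so is its complement. It is pulled back
    to the line by [clamp] to use connectedness of a real segment. *)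
Lemma same_index01 : same_index (itv0 R) (itv1 R).
Proof.
pose C := [set r : R | same_index (itv0 R) (clamp r)].
have Copen : open C.
  rewrite openE => r Cr; apply: (@clamp_continuous R r [set s | same_index (itv0 R) s]).
  apply: filterS (same_index_near (clamp r)) => s.
  exact: same_index_trans.
have Cclosed : closed C.
  rewrite -[C]setCK; apply: open_closedC; rewrite openE => r nCr.
  apply: (@clamp_continuous R r [set s | ~ same_index (itv0 R) s]).
  apply: filterS (same_index_near (clamp r)) => s rs s0.
  by apply: nCr; exact: same_index_trans s0 (same_index_sym rs).
have C0 : C 0 by rewrite /C /= clamp_le0//; exact: nbhs_singleton (same_index_near _).
have CE : `[0, 1]%classic `&` C = `[0, 1]%classic.
  apply: (@segment_connected R 0 1).
  - by exists 0; split => //; rewrite /= in_itv /= lexx ler01.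
  - by exists C.
  - by exists C.
have : (`[0, 1]%classic : set R) 1 by rewrite /= in_itv /= lexx ler01.
by rewrite -CE => -[_]; rewrite /C /= clamp_ge1.
Qed.

End continuation.

(* Nonemptiness says that the common value is a homotopy type, that is, that the
   equation is not one between undefined indices. *)
Theorem theorem4p2 (R : realType) (X : metricType R)
    (Xlc : locally_compact [set: X])
    (f0 f1 : X -> X) (f0_cont : continuous f0) (f1_cont : continuous f1)
    (S0 S1 : set X) (S0_isol : isolated_invariant S0 f0)
    (S1_isol : isolated_invariant S1 f1)
    (cont01 : exists (S_ : unit_itv R -> set X) (f_ : unit_itv R -> X -> X),
       is_continuation S_ f_ S0 f0 S1 f1) :
  CT R S0 f0 = CT R S1 f1 /\ exists P, CT R S0 f0 P.
Proof.
have [S_ [f_ [[S_0 f_0] [S_1 f_1] F_cont Sigma_isol]]] := cont01.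
have same01 := same_index01 Xlc F_cont Sigma_isol.
(* Going to parameter 1 and back compares any two index pairs at parameter 0, which gives
   nonemptiness below. *)
have same00 := same_index_trans same01 (same_index_sym same01).
have CT_sub s t P : same_index S_ f_ s t ->
    CT R (S_ s) (f_ s) P -> CT R (S_ t) (f_ t) P.
  move=> [[N [L ip]] et he] [_ heP]; split => // N' L' ip'.
  exact: homotopy_equivalent_trans (heP _ _ ip) (he _ _ _ _ ip ip').
rewrite -S_0 -f_0 -S_1 -f_1; split.
  apply: functional_extensionality_dep => P; apply: propext.
  by split; apply: CT_sub => //; exact: same_index_sym.
have [[N [L ip]] e0 he] := same00.
exists (mapping_torus R (@index_pair_map X (f_ (itv0 R)) N L)).
by split => // N' L' ip'; exact: he.
Qed.
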